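(* Let $\Omega$ be any infinite set and let $\Sigma$ be a non-empty finite subset of $\Omega$. Then the maximal subsemigroups of $\Omega^\Omega$ containing the pointwise stabiliser $\operatorname{Sym}(\Omega)_{(\Sigma)}$ but not containing $\operatorname{Sym}(\Omega)$ are precisely the sets $$F_1(\Gamma,\mu)=\{f\in\Omega^\Omega : d(f)\geq\mu \text{ or } \Gamma\not\subseteq\Omega f \text{ or } (\Gamma f^{-1}\subseteq\Gamma \text{ and } c(f)<\mu)\}\cup\mathfrak{F},$$ $$F_2(\Gamma,\nu)=\{f\in\Omega^\Omega : c(f)\geq\nu \text{ or } |\Gamma f|<|\Gamma| \text{ or } (\Gamma f=\Gamma \text{ and } d(f)<\nu)\}\cup\mathfrak{F},$$ where $\Gamma$ is a non-empty subset of $\Sigma$ and $\mu$ and $\nu$ are infinite cardinals with $\mu\leq|\Omega|^+$ and either: $|\Gamma|=1$ and $\nu=|\Omega|^+$; or $|\Gamma|\geq 2$ and $\nu\leq|\Omega|^+$.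
   Context: $\Omega^\Omega$ is the semigroup of all mappings from $\Omega$ to itself; mappings are written to the right of their arguments and composed from left to right. $\operatorname{Sym}(\Omega)$ is the symmetric group on $\Omega$. A subsemigroup $T$ of a semigroup $S$ is a maximal subsemigroup if $T\neq S$ and the subsemigroup $\langle T,s\rangle$ generated by $T$ and $s$ equals $S$ for all $s\in S\setminus T$. For $f\in\Omega^\Omega$ and $\Gamma\subseteq\Omega$, $\Gamma f=\{\alpha f:\alpha\in\Gamma\}$ and $\Gamma f^{-1}=\{\beta\in\Omega:\beta f\in\Gamma\}$. A transversal of $f$ is a set $T\subseteq\Omega$ such that $f|_T$ is injective and $Tf=\Omega f$. Put $d(f)=|\Omega\setminus\Omega f|$ and $c(f)=|\Omega\setminus T|$, where $T$ is any transversal of $f$. $\mathfrak{F}=\{f\in\Omega^\Omega:|\Omega f|<|\Omega|\}$. $\operatorname{Sym}(\Omega)_{(\Sigma)}$ is the group of all permutations of $\Omega$ fixing every point of $\Sigma$. $|\Omega|^+$ is the successor cardinal of $|\Omega|$. *)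

(* Defs.v *)
(* MathComp / MathComp-Analysis (classical sets and cardinality). *)
From mathcomp Require Import all_boot.
From mathcomp Require Import boolp classical_sets functions cardinality.

Set Implicit Arguments.
Unset Strict Implicit.
Unset Printing Implicit Defensive.

Local Open Scope classical_set_scope.
Local Open Scope card_scope.

(* A cardinal is represented by any set [mu : set U], over any type [U], having
   that cardinality; only the relations [#<=], [#=] and [#<] are used on it. *)
Definition card_lt T U (A : set T) (B : set U) : Prop :=
  A #<= B /\ ~ (B #<= A).
Notation "A '#<' B" := (card_lt A B) (at level 79) : card_scope.

Definition is_succ_card T U (A : set T) (K : set U) : Prop :=
  A #< K /\ forall (V : Type) (L : set V), A #< L -> K #<= L.

Lemma set_inj_card_le T U (A : set T) (B : set U) (f : T -> U) :
  (forall x, A x -> B (f x)) ->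
  (forall x y, A x -> A y -> f x = f y -> x = y) -> A #<= B.
Proof.
move=> fAB finj.
have [g] : $|{injfun A >-> B}|.
  apply/injfunPex; exists f => // x y /set_mem Ax /set_mem Ay; exact: finj.
exact: inj_card_le.
Qed.

Lemma card_min (V I : Type) (A : I -> set V) (i0 : I) :
  exists i, forall j, A i #<= A j.
Proof.
pose P (S : set (I -> V)) := (forall s, S s -> forall i, A i (s i)) /\
  (forall s t, S s -> S t -> forall i, s i = t i -> s = t).
have [S [[SA Sinj] Smax]] : exists S, P S /\ forall B, S `<` B -> ~ P B.
  apply: Zorn_bigcup => F FP Ftot; split.
    by move=> s [X FX Xs]; case: (FP _ FX) => + _; apply.
  move=> s t [X FX Xs] [Y FY Yt].
  case: (Ftot X Y FX FY) => [XY|YX].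
    by case: (FP _ FY) => _; apply => //; exact: XY.
  by case: (FP _ FX) => _; apply => //; exact: YX.
have [[i Ai]|nAi] := pselect (exists i, A i `<=` [set s i | s in S]).
  exists i => j; apply: (card_le_trans (subset_card_le Ai)).
  apply: (card_le_trans (card_image_le _ _)).
  apply: (@set_inj_card_le _ _ _ _ (fun s => s j)) => [s Ss|s t Ss St].
    exact: SA.
  exact: Sinj.
have v_ i : {v | A i v /\ ~ [set s i | s in S] v}.
  apply: cid; apply: contra_notP nAi => nv; exists i => v Av.
  by apply: contrapT => nSv; apply: nv; exists v.
pose v i := sval (v_ i).
have vS i s : S s -> s i <> v i.
  by move=> Ss siv; have [_] := svalP (v_ i); apply; exists s.
exfalso; apply: (Smax (S `|` [set v])).
  split; first by left.
  by move=> /(_ v (or_intror erefl)) Sv; apply: (vS i0 v Sv).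
split=> [s [/SA//|-> i]|s t]; first by have [] := svalP (v_ i).
move=> [Ss|->] [St|->] i //; first exact: Sinj.
- by move=> siv; case: (vS i s Ss).
- by move=> vti; case: (vS i t St).
Qed.

Lemma card_le_total T U (A : set T) (B : set U) : A #<= B \/ B #<= A.
Proof.
pose A' : set (T + U) := inl @` A; pose B' : set (T + U) := inr @` B.
have AA' : A #<= A'.
  apply: (@set_inj_card_le _ _ _ _ inl) => [x Ax|x y _ _ [] //].
  by exists x.
have BB' : B #<= B'.
  apply: (@set_inj_card_le _ _ _ _ inr) => [x Bx|x y _ _ [] //].
  by exists x.
have [[] min] := card_min (fun b : bool => if b then A' else B') true.
  left; apply: (card_le_trans AA'); apply: card_le_trans (card_image_le _ _).
  exact: (min false).
right; apply: (card_le_trans BB'); apply: card_le_trans (card_image_le _ _).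
exact: (min true).
Qed.

Lemma card_lt_powerset T : [set: T] #< [set: set T].
Proof.
split.
  apply: (@set_inj_card_le _ _ _ _ set1) => // x y _ _ xy.
  by have : [set y] x by rewrite -xy.
move=> /card_leP[f].
pose g (A : set T) : T := val (f (exist _ A (mem_set I))).
have ginj : injective g.
  move=> A B /val_inj AB.
  by have /(congr1 val) := @inj _ _ _ f _ _ (mem_set I) (mem_set I) AB.
pose D := [set x | exists2 A, g A = x & ~ A x].
have nDg : ~ D (g D) by move=> /[dup] DgD [A /ginj -> /(_ DgD)].
by apply: (nDg); exists D.
Qed.

Lemma succ_card_exists T : exists K : set (set T), is_succ_card [set: T] K.
Proof.
pose I := {A : set (set T) | [set: T] #< A}.
have [[K TK] Kmin] :=
  card_min (fun A : I => sval A) (exist _ [set: set T] (card_lt_powerset T)).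
exists K; split=> // V L [TL nLT].
have [LS|SL] := card_le_total L [set: set T]; last first.
  exact: card_le_trans (Kmin (exist _ _ (card_lt_powerset T))) SL.
have /card_leP[f] := LS.
pose h (x : set_type L) : set T := val (f x).
have hinj x y : h x = h y -> x = y.
  by move=> /val_inj; apply: (@inj _ _ _ f); exact: mem_set.
have Lh : L #<= range h.
  apply: (@card_le_trans _ _ _ [set: set_type L]).
    by apply/card_leP; squash to_setT.
  by apply: (@set_inj_card_le _ _ _ _ h) => // x y _ _; exact: hinj.
have hL : range h #<= L.
  apply: (card_le_trans (card_image_le _ _)).
  apply: (@set_inj_card_le _ _ _ _ val) => [x _|x y _ _]; last exact: val_inj.
  exact: set_valP.
have Tlt : [set: T] #< range h.
  split; first exact: card_le_trans TL Lh.
  by move=> hT; apply: nLT; exact: card_le_trans Lh hT.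
exact: card_le_trans (Kmin (exist _ (range h) Tlt)) hL.
Qed.

(* The successor cardinal of |T|, realised as a set of subsets of T. *)
Definition succ_card (T : Type) : set (set T) :=
  sval (cid (succ_card_exists T)).
Arguments succ_card T : clear implicits.

Lemma succ_cardP T : is_succ_card [set: T] (succ_card T).
Proof. exact: svalP (cid (succ_card_exists T)). Qed.

Section Subsemigroups.
Variables (S : Type) (op : S -> S -> S).

Definition subsemigroup (T : set S) : Prop :=
  forall f g, T f -> T g -> T (op f g).

Definition generated (A : set S) : set S := smallest subsemigroup A.

Definition maximal_subsemigroup (T : set S) : Prop :=
  [/\ subsemigroup T, T <> [set: S] &
      forall s, ~ T s -> generated (T `|` [set s]) = [set: S]].

End Subsemigroups.

Section Transformations.
Variable Omega : Type.
Implicit Types (f g : Omega -> Omega) (Gamma Sigma T : set Omega).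

(* Mappings act on the right, so the product [f g] is "first f, then g". *)
Definition mulmap f g : Omega -> Omega := fun x => g (f x).

Definition Sym : set (Omega -> Omega) := [set f | bijective f].

Definition pointwise_stabiliser Sigma : set (Omega -> Omega) :=
  [set f | Sym f /\ forall x, Sigma x -> f x = x].

Definition transversal f T : Prop := set_inj T f /\ f @` T = range f.

Lemma transversal_exists f : exists T, transversal f T.
Proof.
have /choice[t tP] y : exists x, range f y -> f x = y.
  have [[x _ <-]|nfy] := pselect (range f y); first by exists x.
  by exists y.
have ft x : f (t (f x)) = f x by apply: tP; exists x.
exists [set t (f x) | x in setT]; split.
  by move=> _ _ /set_mem[x _ <-] /set_mem[y _ <-]; rewrite !ft => ->.
apply/seteqP; split=> [_ [x _ <-]|_ [x _ <-]]; first by exists x.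
by exists (t (f x)); [exists x|exact: ft].
Qed.

(* [defect f] and [collapse f] are sets whose cardinals are d(f) and c(f). *)
Definition defect f : set Omega := ~` range f.

Definition collapse f : set Omega := ~` sval (cid (transversal_exists f)).

Lemma transversal_compl_le f T T' :
  transversal f T -> transversal f T' -> ~` T #<= ~` T'.
Proof.
move=> [Tinj Tf] [T'inj T'f].
have r_ x : {t | T t /\ f t = f x}.
  apply: cid; have : range f (f x) by exists x.
  by rewrite -Tf => -[t Tt ftx]; exists t.
pose r x := if pselect (T' x) then sval (r_ x) else x.
have T_inj x y : T x -> T y -> f x = f y -> x = y.
  by move=> Tx Ty; apply: Tinj; exact: mem_set.
have T'_inj x y : T' x -> T' y -> f x = f y -> x = y.
  by move=> Tx Ty; apply: T'inj; exact: mem_set.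
apply: (@set_inj_card_le _ _ _ _ r) => [x nTx|x y nTx nTy].
  rewrite /r; case: pselect => // T'x T't; case: (svalP (r_ x)) => Tt ft.
  by apply: nTx; rewrite -(T'_inj _ _ T't T'x ft).
rewrite /r; case: pselect => T'x; case: pselect => T'y //= e.
- apply: T'_inj => //.
  by case: (svalP (r_ x)) => _ <-; case: (svalP (r_ y)) => _ <-; rewrite e.
- by case: (svalP (r_ x)) => Tt _; case: nTy; rewrite -e.
- by case: (svalP (r_ y)) => Tt _; case: nTx; rewrite e.
Qed.

Lemma collapseP f T : transversal f T -> ~` T #= collapse f.
Proof.
move=> fT; have fT' := svalP (cid (transversal_exists f)).
rewrite card_eq_le (transversal_compl_le fT fT').
exact: transversal_compl_le fT' fT.
Qed.

Definition small_range : set (Omega -> Omega) :=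
  [set f | range f #< [set: Omega]].

Definition F1 (U : Type) Gamma (mu : set U) : set (Omega -> Omega) :=
  [set f | [\/ mu #<= defect f, ~ (Gamma `<=` range f) |
               f @^-1` Gamma `<=` Gamma /\ collapse f #< mu]]
  `|` small_range.

Definition F2 (U : Type) Gamma (nu : set U) : set (Omega -> Omega) :=
  [set f | [\/ nu #<= collapse f, f @` Gamma #< Gamma |
               f @` Gamma = Gamma /\ defect f #< nu]]
  `|` small_range.

End Transformations.

Arguments mulmap Omega : clear implicits.
Arguments Sym Omega : clear implicits.

(* Main.v *)
Require Import Defs.
From mathcomp Require Import all_boot.
From mathcomp Require Import boolp classical_sets functions cardinality.

(** Products are read from left to right, and [G] stands for the pointwise
    stabiliser of [Sigma].

    _Each listed set is maximal._  That [F1] and [F2] are closed under products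
    follows from how [defect] and [collapse] behave under composition.  For
    maximality, let [h] lie outside [F2 Gamma nu].  Then [h] is injective on a
    set [A] that contains [Gamma], is as large as [Omega], has fewer than [nu]
    points outside it, and whose image either leaves out at least [nu] points
    or does not cover [Gamma] ([F2_escape]).  If [h] lies outside
    [F1 Gamma mu], the same holds for a section of [h] defined on [A]
    ([F1_escape]).  Either way there is room for writing an arbitrary map [k]
    outside the semigroup as a product [a h b] with [a] and [b] inside it
    ([F1_factorisation], [F2_factorisation]).

    _There are no others._  Let [M] be maximal, containing [G] but not [Sym],
    and suppose that [M] is none of the listed sets.  By maximality [M] lies
    neither in any of them nor in any proper subsemigroup containing [Sym].
    Consider partial injections of [Omega] realised by [M], in one of two ways:
    as restrictions of elements of [M], or as partial sections of elements of
    [M].  Both classes are closed under composition, contain [G] and some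
    non-surjective injection of [Omega], and by the escape lemmas contain, for
    every subset [Gamma] of [Sigma], an injection escaping as above from
    ([Gamma], [nu]) for each infinite cardinal [nu] up to that of [Omega], and
    for its successor as well if [Gamma] is nonempty.  The core of the argument,
    [full_escape], treats both classes at once: such a class has a member
    defined on all of [Omega] whose range misses [Sigma] and leaves out as many
    points as [Omega] has.

    To see this, choose [f0] total, non-surjective, with
    [Gamma := Sigma `&` range f0] minimal.  A total member of the form [p f0]
    meets [Sigma] inside [Gamma], hence exactly in [Gamma].  If an escaping
    injection left some point of [Gamma] uncovered, one could place it
    between a total member and [f0] and so violate minimality; hence it must enlarge the
    complement of the range instead.  Going through all cardinals up to that of
    [Omega], one reaches a total member with full complement, and then the
    escape from ([Gamma], successor of [Omega]), which cannot enlarge anything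
    further, is possible only if [Gamma] is empty.

    Applied to the two classes this gives an injection [f] in [M] and a section
    [s] of some [g] in [M], both with range disjoint from [Sigma] and with full
    complement.  For each permutation [p] some [q] in [G] sends [f x] to
    [s (p x)] for all [x], so [p] is the product [f q g]: thus [M] contains
    [Sym], a contradiction. *)

Set Implicit Arguments.
Unset Strict Implicit.
Unset Printing Implicit Defensive.

Local Open Scope classical_set_scope.
Local Open Scope card_scope.

(* Not the transversals of a partition. *)
Local Notation transversal := Defs.transversal.

(** * Functions from comparisons of cardinals *)

Lemma card_le_fun T U (u : U) (A : set T) (B : set U) : A #<= B ->
  exists f : T -> U, (forall x, A x -> B (f x)) /\
    (forall x y, A x -> A y -> f x = f y -> x = y).
Proof.
move=> /card_leP[F].
exists (fun x => if pselect (A x) is left Ax then val (F (SigSub (mem_set Ax)))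
                 else u).
split=> [x Ax|x y Ax Ay].
  by case: pselect => // Ax'; exact: set_valP.
case: pselect => // Ax'; case: pselect => // Ay' /val_inj.
by move=> /(@inj _ _ _ F _ _ (mem_set I) (mem_set I)) /(congr1 val).
Qed.

Lemma card_eq_fun T U (t : T) (u : U) (A : set T) (B : set U) : A #= B ->
  exists f : T -> U, exists g : U -> T,
    [/\ forall x, A x -> B (f x), forall y, B y -> A (g y),
        forall x, A x -> g (f x) = x & forall y, B y -> f (g y) = y].
Proof.
move=> /card_bijP[F [G FK GK]].
pose f x := if pselect (A x) is left Ax then val (F (SigSub (mem_set Ax))) else u.
pose g x := if pselect (B x) is left Bx then val (G (SigSub (mem_set Bx))) else t.
exists f, g; split.
- by move=> x Ax; rewrite /f; case: pselect => // Ax'; exact: set_valP.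
- by move=> x Ax; rewrite /g; case: pselect => // Ax'; exact: set_valP.
- move=> x Ax; rewrite /f; case: pselect => // Ax'; rewrite /g.
  case: pselect => [Bx|[]]; last exact: set_valP.
  rewrite -[RHS]/(val (SigSub (mem_set Ax'))) -[in RHS](FK (SigSub _)).
  by congr (val (G _)); exact: val_inj.
- move=> x Ax; rewrite /g; case: pselect => // Ax'; rewrite /f.
  case: pselect => [Bx|[]]; last exact: set_valP.
  rewrite -[RHS]/(val (SigSub (mem_set Ax'))) -[in RHS](GK (SigSub _)).
  by congr (val (F _)); exact: val_inj.
Qed.

Lemma card_image_inj T U (f : T -> U) (A : set T) :
  (forall x y, A x -> A y -> f x = f y -> x = y) -> f @` A #= A.
Proof. by move=> fi; apply: inj_card_eq => x y /set_mem Ax /set_mem Ay; exact: fi. Qed.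

Lemma card_eq_leL T U (A : set T) (B : set U) : A #= B -> A #<= B.
Proof. by rewrite card_eq_le => /andP[]. Qed.

Lemma card_eq_leR T U (A : set T) (B : set U) : A #= B -> B #<= A.
Proof. by rewrite card_eq_le => /andP[]. Qed.

Lemma card_eq_antisym T U (A : set T) (B : set U) : A #<= B -> B #<= A -> A #= B.
Proof. by rewrite card_eq_le => -> ->. Qed.

Lemma card_ltNge T U (A : set T) (B : set U) : ~ (B #<= A) <-> A #< B.
Proof.
split=> [nBA|[]//]; split=> //.
by have [//|/nBA[]] := card_le_total A B.
Qed.

Lemma card_nltge T U (A : set T) (B : set U) : ~ (A #< B) <-> B #<= A.
Proof.
split=> [nAB|BA [_]]; last exact.
by apply: contrapT => /card_ltNge.
Qed.

Lemma card_lt_le_trans T U V (A : set T) (B : set U) (C : set V) :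
  A #< B -> B #<= C -> A #< C.
Proof.
move=> [AB nBA] BC; split; first exact: card_le_trans BC.
by move=> /(card_le_trans BC).
Qed.

Lemma card_le_lt_trans T U V (A : set T) (B : set U) (C : set V) :
  A #<= B -> B #< C -> A #< C.
Proof.
move=> AB [BC nCB]; split; first exact: card_le_trans BC.
by move=> CA; apply: nCB; exact: card_le_trans AB.
Qed.

Lemma infinite_card_le T U (A : set T) (B : set U) :
  infinite_set A -> A #<= B -> infinite_set B.
Proof. by move=> Ainf AB /(card_le_finite AB). Qed.

Lemma finite_card_lt T U (A : set T) (B : set U) :
  finite_set A -> infinite_set B -> A #< B.
Proof. by move=> Af Bi; apply/card_ltNge => /card_le_finite /(_ Af). Qed.

(** * Finite sets *)

Lemma finite_set_ind T (P : set T -> Prop) : P set0 ->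
  (forall x A, ~ A x -> P A -> P (x |` A)) -> forall A, finite_set A -> P A.
Proof.
move=> P0 PS A /finite_setP[n]; elim: n A => [|n IHn] A.
  by rewrite II0 card_eq0 => /eqP ->.
move=> /eq_cardSP[x Ax /IHn PAx]; rewrite -(setD1K Ax).
by apply: PS => // -[_ nx]; exact: nx.
Qed.

(** If [a] were missed, its iterates under [f] would be pairwise distinct. *)
Lemma finite_inj_surj T (A : set T) (f : T -> T) : finite_set A ->
  (forall x, A x -> A (f x)) -> (forall x y, A x -> A y -> f x = f y -> x = y) ->
  A `<=` f @` A.
Proof.
move=> Afin fA finj a Aa; apply: contrapT => naf.
have Ai n : A (iter n f a) by elim: n => //= n; exact: fA.
apply: (infinite_nat); apply: card_le_finite Afin.
apply: (@set_inj_card_le _ _ _ _ (fun n => iter n f a)) => // m n _ _.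
elim: m n => [|m IH] [|n]//=.
- by move=> e; case: naf; exists (iter n f a).
- by move=> e; case: naf; exists (iter m f a).
- by move=> /(finj _ _ (Ai m) (Ai n)) /IH ->.
Qed.

Lemma finite_sub_eq T (A B : set T) : finite_set A -> B `<=` A -> A #<= B -> B = A.
Proof.
move=> Afin BA AB; apply/seteqP; split=> // a Aa.
have [f [fAB finj]] := card_le_fun a AB.
have [b Ab <-] := finite_inj_surj Afin (fun x Ax => BA _ (fAB x Ax)) finj Aa.
exact: fAB.
Qed.

(** Compose an injection of [A] into its image with a section of [f]: the result
    is an injection of [A] into itself, hence onto, so that every point of [A]
    is a value of the section, on which [f] is injective. *)
Lemma finite_card_image_inj T U (f : T -> U) (A : set T) :
  finite_set A -> A #<= f @` A ->
  forall x y, A x -> A y -> f x = f y -> x = y.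
Proof.
move=> Afin AfA x y Ax Ay.
have [i [iA iinj]] := card_le_fun (f x) AfA.
have /choice[r rP] z : exists t, (f @` A) z -> A t /\ f t = z.
  by have [[t At <-]|nz] := pselect ((f @` A) z); [exists t|exists x].
have surj a : A a -> exists2 z, (f @` A) z & r z = a.
  move=> Aa; have [||b Ab <-] := @finite_inj_surj _ A (r \o i) Afin _ _ a Aa.
  - by move=> b /iA /rP[].
  - move=> b c Ab Ac /= e; apply: iinj => //.
    by have [_ <-] := rP _ (iA _ Ab); have [_ <-] := rP _ (iA _ Ac); rewrite e.
  - by exists (i b) => //; exact: iA.
have [a Aa <-] := surj x Ax; have [b Ab <-] := surj y Ay.
by have [_ ->] := rP _ Aa; have [_ ->] := rP _ Ab => ->.
Qed.

(** Hilbert's hotel: shift a sequence of distinct points of [W] by one place. *)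
Lemma card_setU1_infinite T (x : T) (W : set T) : infinite_set W -> x |` W #<= W.
Proof.
have [Wx _|nWx /infiniteP] := pselect (W x).
  by apply: subset_card_le => y [->|].
move=> /(card_le_fun x) [s [sW sinj]].
(* [x] takes the first place of the sequence [s], whose points move up. *)
pose k y := if pselect (exists n, s n = y) is left e then s (sval (cid e)).+1
            else if pselect (y = x) then s 0 else y.
have ks n : k (s n) = s n.+1.
  rewrite /k; case: pselect => [e|[]]; last by exists n.
  by congr (s _.+1); apply: sinj => //; exact: svalP (cid e).
have kN y : ~ (exists n, s n = y) -> y <> x -> k y = y.
  by move=> sy yx; rewrite /k; case: pselect => // _; case: pselect.
have kx : k x = s 0.
  rewrite /k; case: pselect => [[n snx]|_]; last by case: pselect.
  by case: nWx; rewrite -snx; exact: sW.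
have spl y : W y -> (exists n, y = s n) \/ (~ (exists n, s n = y) /\ y <> x).
  move=> Wy; have [[n <-]|nn] := pselect (exists n, s n = y); first by left; exists n.
  by right; split=> // yx; apply: nWx; rewrite -yx.
apply: (@set_inj_card_le _ _ _ _ k) => [y [->|/[dup] Wy /spl]|y z].
- by rewrite kx; exact: sW.
- by move=> [[n ->]|[? ?]]; rewrite ?ks ?kN//; exact: sW.
- have inj0 m n : s m = s n -> m = n by exact: sinj.
  move=> [->|/spl[[m ->]|[? ?]]] [->|/spl[[n ->]|[? ?]]] //; rewrite ?kx ?ks ?kN//.
  + by move=> /inj0.
  + by move=> sz; exfalso; eauto.
  + by move=> /inj0.
  + by move=> /inj0 [->].
  + by move=> sz; exfalso; eauto.
  + by move=> sz; exfalso; eauto.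
  + by move=> sz; exfalso; eauto.
Qed.

Lemma card_setU_finite T (F W : set T) :
  finite_set F -> infinite_set W -> F `|` W #<= W.
Proof.
move=> Ffin Winf; elim/finite_set_ind: F / Ffin => [|x F _ IH].
  by rewrite set0U.
rewrite -setUA; apply: card_le_trans IH; apply: card_setU1_infinite.
by apply: infinite_card_le Winf _; apply: subset_card_le => y; right.
Qed.

Lemma card_setD_finite T (F W : set T) :
  finite_set F -> infinite_set W -> W `\` F #= W.
Proof.
move=> Ffin Winf; apply: card_eq_antisym; first exact: card_le_setD.
apply: card_le_trans (card_setU_finite Ffin (infinite_setD Winf Ffin)).
by apply: subset_card_le => y Wy; have [Fy|Fy] := pselect (F y); [left|right].
Qed.

(** * Sums of infinite cardinals *)

(** Two disjoint copies of an infinite set fit into it.  A maximal family of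
    pairwise disjoint sequences in [C] leaves out only finitely many points, so
    [C] embeds into the points [W] of these sequences; and [W] is doubled by
    sending the [n]-th place of a sequence to its places [2n] and [2n + 1]. *)
Lemma infinite_doubling T (C : set T) : infinite_set C ->
  exists j : bool -> T -> T, (forall b x, C x -> C (j b x)) /\
    forall b c x y, C x -> C y -> j b x = j c y -> b = c /\ x = y.
Proof.
move=> Cinf; have [u _] := infinite_setN0 Cinf.
pose P (X : set (nat -> T)) := (forall s, X s -> forall n, C (s n)) /\
  (forall s t m n, X s -> X t -> s m = t n -> s = t /\ m = n).
have [X [[XC Xinj] Xmax]] : exists X, P X /\ forall Y, X `<` Y -> ~ P Y.
  apply: Zorn_bigcup => F FP Ftot; split.
    by move=> s [Y FY Ys]; case: (FP _ FY) => + _; apply.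
  move=> s t m n [Y FY Ys] [Z FZ Zt].
  case: (Ftot Y Z FY FZ) => YZ.
    by case: (FP _ FZ) => _; apply => //; exact: YZ.
  by case: (FP _ FY) => _; apply => //; exact: YZ.
pose W := [set y | exists2 s, X s & exists n, s n = y].
have WC : W `<=` C by move=> _ [s Xs [n <-]]; exact: XC.
have CWfin : finite_set (C `\` W).
  apply: contrapT => /infiniteP /(card_le_fun u)[s [sCW sinj]].
  have nXs t m n : X t -> s m <> t n.
    by move=> Xt e; have [_ []] := sCW m I; exists t => //; exists n.
  apply: (Xmax (X `|` [set s])).
    split=> [|XsX]; first by left.
    by have := nXs s 0 0 (XsX s (or_intror erefl)).
  split=> [t [/XC//|->] n|t r m n [Xt|->] [Xr|->]]; first by have [] := sCW n I.
  - exact: Xinj.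
  - by move=> /esym /(nXs _ _ _ Xt).
  - by move=> /(nXs _ _ _ Xr).
  - by move=> /sinj ->.
have Winf : infinite_set W.
  by move=> Wfin; apply: Cinf; rewrite -(setDUK WC) finite_setU.
have [phi [phiW phiinj]] : exists f : T -> T, (forall x, C x -> W (f x)) /\
    (forall x y, C x -> C y -> f x = f y -> x = y).
  apply: (card_le_fun u); rewrite -[X in X #<= _](setDUK WC) setUC.
  exact: card_setU_finite.
have /choice[J JP] y : exists z : bool -> T, W y -> exists2 s, X s &
    exists2 n, s n = y & forall b : bool, z b = s (n.*2 + b)%N.
  have [[s Xs [n sn]]|nW] := pselect (W y); last by exists (fun=> u).
  by exists (fun b => s (n.*2 + b)%N) => _; exists s => //; exists n.
exists (fun b x => J (phi x) b); split=> [b x /phiW /JP[s Xs [n _ ->]]|].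
  exact: XC.
move=> b c x y Cx Cy.
have [s Xs [m sm ->]] := JP _ (phiW _ Cx).
have [t Xt [n tn ->]] := JP _ (phiW _ Cy).
move=> /(Xinj _ _ _ _ Xs Xt) [st e].
have bc : b = c by move/(congr1 odd): e; rewrite !oddD !odd_double !oddb.
split=> //; apply: phiinj => //; rewrite -sm -tn st; congr t.
by move: e; rewrite bc => /eqP; rewrite eqn_add2r -!muln2 eqn_pmul2r // => /eqP.
Qed.

Lemma card_setU_le T U (C : set T) (A B : set U) :
  infinite_set C -> A #<= C -> B #<= C -> A `|` B #<= C.
Proof.
move=> Cinf AC BC; have [u _] := infinite_setN0 Cinf.
have [j [jC jinj]] := infinite_doubling Cinf.
have [f [fC finj]] := card_le_fun u AC.
have [g [gC ginj]] := card_le_fun u BC.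
pose k x := if pselect (A x) is left _ then j true (f x) else j false (g x).
apply: (@set_inj_card_le _ _ _ _ k) => [x|x y]; rewrite /k.
  by case: pselect => [Ax _|nAx [//|Bx]]; apply: jC; [exact: fC|exact: gC].
case: pselect => [Ax _|nAx [//|Bx]]; case: pselect => [Ay _|nAy [//|By]].
- by move=> /jinj[]; [exact: fC|exact: fC|move=> _ /finj; exact].
- by move=> /jinj[]//; [exact: fC|exact: gC].
- by move=> /jinj[]//; [exact: gC|exact: fC].
- by move=> /jinj[]; [exact: gC|exact: gC|move=> _ /ginj; exact].
Qed.

Lemma infinite_card_le_setU T U (mu : set T) (A B : set U) :
  infinite_set mu -> mu #<= A `|` B -> mu #<= A \/ mu #<= B.
Proof.
move=> muinf muAB.
wlog AB : A B muAB / A #<= B.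
  have [AB|BA] := card_le_total A B; first by apply.
  by move=> /(_ B A) []//; rewrite 1?setUC; [|right|left].
right; apply: (card_le_trans muAB).
have Binf : infinite_set B.
  move=> Bfin; have := infinite_card_le muinf muAB; apply.
  by rewrite finite_setU; split=> //; exact: card_le_finite Bfin.
exact: card_setU_le.
Qed.

Lemma card_setU_lt T U (mu : set T) (A B : set U) :
  infinite_set mu -> A #< mu -> B #< mu -> A `|` B #< mu.
Proof.
move=> muinf Amu Bmu; apply/card_ltNge.
by move=> /(infinite_card_le_setU muinf)[]; exact/card_ltNge.
Qed.

(** * Bijections and subsets as large as the whole set *)

Lemma inj_surj_bijective T U (f : T -> U) :
  injective f -> range f = setT -> bijective f.
Proof.
move=> finj fsurj.
have /choice[g fg] y : exists x, f x = y.
  by have : range f y by [rewrite fsurj]; move=> [x _ <-]; exists x.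
by exists g => // x; apply: finj.
Qed.

Section Full.
Variable Omega : Type.
Hypothesis Oinf : infinite_set [set: Omega].
Implicit Types (A B F Gamma : set Omega) (f g : Omega -> Omega).

Definition full A := [set: Omega] #<= A.

Lemma full_card A B : full A -> full B -> A #= B.
Proof.
move=> fA fB; apply: card_eq_antisym.
  exact: card_le_trans (card_leT A) fB.
exact: card_le_trans (card_leT B) fA.
Qed.

Lemma full_sub A B : A `<=` B -> full A -> full B.
Proof. by move=> /subset_card_le AB fA; exact: card_le_trans AB. Qed.

Lemma fullD A F : finite_set F -> full A -> full (A `\` F).
Proof.
move=> Ff fA; apply: (card_le_trans fA); apply: card_eq_leR.
by apply: card_setD_finite => //; exact: infinite_card_le fA.
Qed.

Lemma bijective_extension A f : (forall x y, A x -> A y -> f x = f y -> x = y) ->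
  full (~` A) -> full (~` (f @` A)) ->
  exists q r, [/\ cancel q r, cancel r q & forall x, A x -> q x = f x].
Proof.
move=> finj fA ffA; have [w _] := infinite_setN0 Oinf.
have [h [k [hA kA hK kK]]] := card_eq_fun w w (full_card fA ffA).
pose q x := if pselect (A x) is left _ then f x else h x.
have qA x : A x -> q x = f x by rewrite /q; case: pselect.
have qN x : ~ A x -> q x = h x by rewrite /q; case: pselect.
have qinj : injective q.
  move=> x y; have [Ax|Ax] := pselect (A x); have [Ay|Ay] := pselect (A y).
  - by rewrite !qA//; exact: finj.
  - by rewrite qA// qN// => e; case: (hA y Ay); rewrite -e; exists x.
  - by rewrite qN// qA// => e; case: (hA x Ax); rewrite e; exists y.
  - by rewrite !qN// => e; rewrite -(hK x)// e hK.
have qsurj : range q = setT.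
  apply/seteqP; split=> // y _; have [[x Ax <-]|ny] := pselect ((f @` A) y).
    by exists x => //; rewrite qA.
  by exists (k y) => //; rewrite qN ?kK//; exact: kA.
by have [r qr rq] := inj_surj_bijective qinj qsurj; exists q, r; split.
Qed.

(** What lies outside [Gamma] is as large in [A] as it is in [Omega]. *)
Lemma full_bij_fixing A Gamma : finite_set Gamma -> Gamma `<=` A -> full A ->
  exists phi psi : Omega -> Omega, [/\ forall x, A (phi x), cancel phi psi,
    forall y, A y -> phi (psi y) = y & forall x, Gamma x -> phi x = x].
Proof.
move=> Gfin GA fA; have [w _] := infinite_setN0 Oinf.
have [h [k [hA kA hK kK]]] := card_eq_fun w w
  (full_card (fullD Gfin (card_lexx setT)) (fullD Gfin fA)).
pose phi x := if pselect (Gamma x) is left _ then x else h x.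
pose psi x := if pselect (Gamma x) is left _ then x else k x.
exists phi, psi; split=> [x|x|y Ay|x Gx]; rewrite /phi ?/psi; last by case: pselect.
- by case: pselect => [/GA//|nGx]; have [] := hA x (conj I nGx).
- case: (pselect (Gamma x)) => Gx; first by case: pselect.
  by case: pselect => [|_]; [have [] := hA x (conj I Gx)|rewrite hK].
- case: (pselect (Gamma y)) => [Gy|nGy]; first by case: pselect.
  by case: pselect => [|_]; [have [] := kA y (conj Ay nGy)|rewrite kK].
Qed.

Lemma exists_co_full_injection : exists e : Omega -> Omega, injective e /\ full (~` range e).
Proof.
have [j [_ jinj]] := infinite_doubling Oinf.
exists (j true); split=> [x y /jinj[]//|].
apply: (@set_inj_card_le _ _ _ _ (j false)) => [x _ [y _ /jinj[]//]|x y _ _].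
by move=> /jinj[].
Qed.

End Full.

(** * Defect and collapse of products *)

Section Transversals.
Variable Omega : Type.
Hypothesis Oinf : infinite_set [set: Omega].
Implicit Types (A B C F Gamma S T : set Omega) (f g : Omega -> Omega).

Lemma transversal_between f A C :
  (forall x y, A x -> A y -> f x = f y -> x = y) -> A `<=` C ->
  range f `<=` f @` C -> exists T, [/\ transversal f T, A `<=` T & T `<=` C].
Proof.
move=> finj AC fC; have [w _] := infinite_setN0 Oinf.
have /choice[r rP] y : exists x, [/\ range f y -> f x = y, range f y -> C x &
    forall a, A a -> f a = y -> x = a].
  have [[a Aa <-]|nA] := pselect ((f @` A) y).
    by exists a; split=> // [_|b Ab e]; [exact: AC|apply: finj].
  have nAy a : A a -> f a <> y by move=> Aa e; apply: nA; exists a.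
  have [/fC[x Cx xy]|ny] := pselect (range f y).
    by exists x; split=> // a Aa /nAy[].
  by exists w; split=> // a Aa /nAy[].
have rr x : f (r (f x)) = f x by have [-> //] := rP (f x); exists x.
exists [set r (f x) | x in setT]; split.
- split.
    by move=> _ _ /set_mem[x _ <-] /set_mem[y _ <-]; rewrite !rr => ->.
  apply/seteqP; split=> [_ [_ [x _ <-] <-]|_ [x _ <-]]; first by exists (r (f x)).
  by exists (r (f x)); [exists x|rewrite rr].
- by move=> a Aa; exists a => //; have [_ _] := rP (f a); apply.
- by move=> _ [x _ <-]; have [_ + _] := rP (f x); apply; exists x.
Qed.

Lemma transversal_above f A :
  (forall x y, A x -> A y -> f x = f y -> x = y) ->
  exists2 T, transversal f T & A `<=` T.
Proof.
move=> finj; have [//|T [Tf AT _]] := transversal_between finj (@subsetT _ A) _.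
by exists T.
Qed.

Lemma transversal_injP f T x y : transversal f T -> T x -> T y -> f x = f y -> x = y.
Proof. by move=> [Tinj _] Tx Ty; apply: Tinj; exact: mem_set. Qed.

Lemma transversal_image f T : transversal f T -> T #= range f.
Proof.
move=> fT; have [_ <-] := fT; rewrite card_eq_sym; apply: card_image_inj.
by move=> x y; exact: transversal_injP.
Qed.

(* The products below read from left to right: first [f], then [g]. *)
Lemma defect_mulr f g : defect g `<=` defect (mulmap _ f g).
Proof. by move=> y ny [x _ xy]; apply: ny; exists (f x). Qed.

Lemma defect_mul_lt U (mu : set U) f g : infinite_set mu ->
  defect f #< mu -> defect g #< mu -> defect (mulmap _ f g) #< mu.
Proof.
move=> muinf fmu gmu; apply: card_le_lt_trans (_ : defect g `|` g @` defect f #< _).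
  apply: subset_card_le => y ny; have [[x _ xy]|ngy] := pselect (range g y); last by left.
  by right; exists x => // -[z _ zx]; apply: ny; exists z; rewrite // /mulmap zx.
apply: card_setU_lt => //; apply: card_le_lt_trans fmu; exact: card_image_le.
Qed.

(** On a transversal of [g], the points outside the range of [f] are moved
    injectively, and one of them can land in the range of the product only if it
    has a companion in the range of [f] with the same image under [g]; that
    companion lies outside the transversal, so this happens fewer than [mu]
    times. *)
Lemma le_defect_mul U (mu : set U) f g : infinite_set mu ->
  mu #<= defect f -> collapse g #< mu -> mu #<= defect (mulmap _ f g).
Proof.
move=> muinf muf gmu; have [T gT] := transversal_exists g.
have ltT A : A #<= ~` T -> ~ (mu #<= A).
  move=> AT; apply/card_ltNge; apply: card_le_lt_trans gmu.
  exact: card_le_trans (card_eq_leL (collapseP gT)).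
pose D := defect f `&` T.
have /infinite_card_le_setU : mu #<= D `|` ~` T.
  apply: (card_le_trans muf); apply: subset_card_le => x fx.
  by have [Tx|nTx] := pselect (T x); [left|right].
move=> /(_ muinf)[muD|/(ltT _ (card_lexx _))[]].
pose E := defect (mulmap _ f g).
have /infinite_card_le_setU : mu #<= D `&` g @^-1` E `|` D `&` g @^-1` (~` E).
  apply: (card_le_trans muD); apply: subset_card_le => x Dx.
  by have [Ex|nEx] := pselect (E (g x)); [left|right].
move=> /(_ muinf)[muE|].
  apply: (card_le_trans muE); apply: (@set_inj_card_le _ _ _ _ g) => [x []//|x y].
  by move=> [[_ Tx] _] [[_ Ty] _]; exact: transversal_injP gT Tx Ty.
have /choice[h hP] x : exists z, D x -> ~ E (g x) ->
    range f z /\ g z = g x.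
  have [[Dx /contrapT[z _ zx]]|nx] := pselect (D x /\ ~ E (g x)).
    by exists (f z) => _ _; split=> //; exists z.
  by exists x => Dx nEx; case: nx.
move=> muE'; exfalso; move: muE'; apply: ltT.
apply: (@set_inj_card_le _ _ _ _ h) => [x [Dx nEx] Thx|x y [Dx nEx] [Dy nEy] e].
  have [fhx hx] := hP x Dx nEx; have [nfx Tx] := Dx; apply: nfx.
  by rewrite -(transversal_injP gT Thx Tx hx).
have [_ hx] := hP x Dx nEx; have [_ hy] := hP y Dy nEy.
case: Dx => _ Tx; case: Dy => _ Ty; apply: (transversal_injP gT Tx Ty).
by rewrite -hx -hy e.
Qed.

Lemma collapse_mull f g : collapse f #<= collapse (mulmap _ f g).
Proof.
have [P fgP] := transversal_exists (mulmap _ f g).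
have [|T fT PT] := @transversal_above f P.
  move=> x y Px Py e; apply: (transversal_injP fgP Px Py).
  by rewrite /mulmap e.
apply: card_le_trans (card_eq_leR (collapseP fT)) _.
apply: card_le_trans (card_eq_leL (collapseP fgP)).
by apply: subset_card_le; exact: subsetC.
Qed.

(** [f] carries a transversal of the product to one of [g] restricted to the range
    of [f]; extending it adds no further point of that range. *)
Lemma transversal_mul f g P : transversal (mulmap _ f g) P ->
  exists S, [/\ transversal g S, f @` P `<=` S & S `&` range f `<=` f @` P].
Proof.
move=> fgP; have [|S gS PS] := @transversal_above g (f @` P).
  by move=> _ _ [x Px <-] [y Py <-] /(transversal_injP fgP Px Py) ->.
exists S; split=> // y [Sy [x _ xy]].
have [_ PE] := fgP; have : range (mulmap _ f g) (mulmap _ f g x) by exists x.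
rewrite -PE => -[z Pz zx]; exists z => //; rewrite -xy.
by apply: (transversal_injP gS) => //; [apply: PS; exists z|rewrite xy].
Qed.

Lemma collapse_mul_lt U (mu : set U) f g : infinite_set mu ->
  collapse f #< mu -> collapse g #< mu -> collapse (mulmap _ f g) #< mu.
Proof.
move=> muinf fmu gmu; have [P fgP] := transversal_exists (mulmap _ f g).
have [S [gS PS SP]] := transversal_mul fgP.
have [|T fT PT] := @transversal_above f P.
  by move=> x y Px Py e; apply: (transversal_injP fgP Px Py); rewrite /mulmap e.
apply: card_le_lt_trans (card_eq_leR (collapseP fgP)) _.
apply: card_le_lt_trans (_ : ~` T `|` (T `\` P) #< _).
  apply: subset_card_le => x nPx.
  by have [Tx|nTx] := pselect (T x); [right|left].
apply: card_setU_lt => //.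
  exact: card_le_lt_trans (card_eq_leL (collapseP fT)) _.
apply: card_le_lt_trans gmu; apply: card_le_trans (card_eq_leL (collapseP gS)).
apply: (@set_inj_card_le _ _ _ _ f) => [x [Tx nPx] Sfx|x y [Tx _] [Ty _]].
  have [z Pz zx] : (f @` P) (f x) by apply: SP; split=> //; exists x.
  by apply: nPx; rewrite -(transversal_injP fT (PT _ Pz) Tx zx).
exact: transversal_injP fT Tx Ty.
Qed.

Lemma le_collapse_mul U (nu : set U) f g : infinite_set nu ->
  defect f #< nu -> nu #<= collapse g -> nu #<= collapse (mulmap _ f g).
Proof.
move=> nuinf fnu nug; have [P fgP] := transversal_exists (mulmap _ f g).
have [S [gS PS SP]] := transversal_mul fgP.
have /infinite_card_le_setU : nu #<= (range f `\` f @` P) `|` defect f.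
  apply: card_le_trans nug _; apply: card_le_trans (card_eq_leR (collapseP gS)) _.
  apply: subset_card_le => x nSx.
  by have [fx|nfx] := pselect (range f x); [left; split=> // /PS|right].
move=> /(_ nuinf)[nuP|]; last by move=> /card_nltge.
apply: (card_le_trans nuP); apply: card_le_trans (card_eq_leL (collapseP fgP)).
apply: card_le_trans (_ : f @` (~` P) #<= _); last exact: card_image_le.
apply: subset_card_le => _ [[x _ <-] nfP]; by exists x => // Px; apply: nfP; exists x.
Qed.

End Transversals.

(** * The semigroups [F1] and [F2], and how maps escape from them *)

Section Semigroups.
Variable Omega : Type.
Hypothesis Oinf : infinite_set [set: Omega].
Implicit Types (A F Gamma S T : set Omega) (f g h k : Omega -> Omega).

Lemma small_range_mulr f g : small_range g -> small_range (mulmap _ f g).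
Proof.
apply: card_le_lt_trans; apply: subset_card_le => _ [x _ <-].
by exists (f x).
Qed.

Lemma small_range_mull f g : small_range f -> small_range (mulmap _ f g).
Proof.
apply: card_le_lt_trans; apply: card_le_trans (card_image_le g _).
by apply: subset_card_le => _ [x _ <-]; exists (f x) => //; exists x.
Qed.

Lemma full_range f : ~ small_range f -> full (range f).
Proof. by move=> /card_nltge. Qed.

(** If [g] is of the third kind and its range contains [Gamma], then [g] permutes
    the finite set [Gamma], which is what makes the products behave. *)
Lemma F1_subsemigroup U (mu : set U) Gamma :
  finite_set Gamma -> infinite_set mu -> subsemigroup (mulmap Omega) (F1 Gamma mu).
Proof.
move=> Gfin muinf f g Ff Fg.
have [[D|nG|[gG gmu]]|sg] := Fg; last by right; exact: small_range_mulr.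
- left; apply: Or31; apply: card_le_trans D _; apply: subset_card_le.
  exact: defect_mulr.
- left; apply: Or32 => GG; apply: nG => y /GG[x _ <-].
  by exists (f x).
have [Gg|nGg] := pselect (Gamma `<=` range g); last first.
  left; apply: Or32 => GG; apply: nGg => y /GG[x _ <-].
  by exists (f x).
have GgG : Gamma `<=` g @` Gamma.
  by move=> y Gy; have [x _ xy] := Gg y Gy; exists x => //; apply: gG; rewrite /= xy.
have GE : Gamma = g @` Gamma.
  apply: finite_sub_eq => //; first exact: finite_image.
  exact: card_image_le.
have ginj := finite_card_image_inj Gfin (subset_card_le GgG).
have [[D|nG|[fG fmu]]|sf] := Ff; last by right; exact: small_range_mull.
- by left; apply: Or31; exact: le_defect_mul.
- left; apply: Or32 => GG; apply: nG => y Gy.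
  have Ggy : Gamma (g y) by rewrite GE; exists y.
  have [x _ xy] := GG _ Ggy; exists x => //.
  by apply: ginj => //; apply: gG; rewrite /= -/(mulmap _ f g x) xy.
- left; apply: Or33; split; last exact: collapse_mul_lt.
  by move=> x /gG /fG.
Qed.

Lemma F2_subsemigroup U (nu : set U) Gamma :
  infinite_set nu -> subsemigroup (mulmap Omega) (F2 Gamma nu).
Proof.
move=> nuinf f g Ff Fg.
have [[C|sG|[fG fnu]]|sf] := Ff; last by right; exact: small_range_mull.
- by left; apply: Or31; apply: card_le_trans C _; exact: collapse_mull.
- left; apply: Or32; apply: card_le_lt_trans sG; rewrite -image_comp.
  exact: card_image_le.
have fgG : mulmap _ f g @` Gamma = g @` Gamma by rewrite -[in RHS]fG image_comp.
have [[C|sG|[gG gnu]]|sg] := Fg; last by right; exact: small_range_mulr.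
- by left; apply: Or31; exact: le_collapse_mul.
- by left; apply: Or32; rewrite fgG.
- by left; apply: Or33; rewrite fgG; split=> //; exact: defect_mul_lt.
Qed.

(** What the maps outside [F1] and those outside [F2] have in common, seen on a
    section in the first case and on a restriction in the second: such a partial
    injection [p] turns a small complement into a large one, or a set containing
    [Gamma] into one that does not contain it. *)
Definition escapes U (mu : set U) Gamma A (p : Omega -> Omega) : Prop :=
  [/\ Gamma `<=` A, full A, ~` A #< mu &
      mu #<= ~` (p @` A) \/ ~ (Gamma `<=` p @` A)].

Lemma transversal_section h T : transversal h T ->
  exists t : Omega -> Omega, forall y, range h y -> T (t y) /\ h (t y) = y.
Proof.
move=> [_ hT]; have /choice[t tP] y : exists x, range h y -> T x /\ h x = y.
  have [|ny] := pselect (range h y); last by exists y.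
  by rewrite -hT => -[x Tx <-]; exists x.
by exists t.
Qed.

(** The section [t] may use any point of each fibre.  If [h] maps some [x] outside
    [Gamma] into [Gamma], let [t] use [x]: then [t] does not map [Gamma] onto
    itself, and some [c] in [Gamma] is left uncovered by [t] once the at most one
    point sent to it is discarded from the domain. *)
Lemma F1_escape U (mu : set U) Gamma h : finite_set Gamma -> infinite_set mu ->
  ~ F1 Gamma mu h ->
  exists A t, (forall y, A y -> h (t y) = y) /\ escapes mu Gamma A t.
Proof.
move=> Gfin muinf nF.
have hfull : full (range h) by apply: full_range => sh; apply: nF; right.
have hmu : defect h #< mu.
  by apply/card_ltNge => D; apply: nF; left; apply: Or31.
have Gh : Gamma `<=` range h by apply: contrapT => nG; apply: nF; left; apply: Or32.
have [hG|] := pselect (h @^-1` Gamma `<=` Gamma).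
  have [T hT] := transversal_exists h; have [t tP] := transversal_section hT.
  exists (range h), t; split; first by move=> y /tP[].
  split=> //; left.
  have muh : mu #<= collapse h.
    by apply/card_nltge => c; apply: nF; left; apply: Or33.
  apply: (card_le_trans muh); apply: card_le_trans (card_eq_leR (collapseP hT)) _.
  by apply: subset_card_le; apply: subsetC => _ [y /tP[Tt _] <-].
move=> /existsNP[x /not_implyP[Ghx nGx]].
have [|T hT xT] := @transversal_above _ Oinf h [set x].
  by move=> y z /= -> ->.
have [t tP] := transversal_section hT.
have hx : range h (h x) by exists x.
have thx : t (h x) = x.
  by have [Tt e] := tP _ hx; exact: (transversal_injP hT Tt (xT _ erefl) e).
have [c [Gc tc]] : exists c, Gamma c /\ ~ (t @` Gamma) c.
  apply: contrapT => nc; apply: nGx.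
  have -> : Gamma = t @` Gamma; last by exists (h x).
  apply: finite_sub_eq; [exact: finite_image| |exact: card_image_le].
  by move=> c Gc; apply: contrapT => tc; apply: nc; exists c.
exists (range h `&` [set y | t y <> c]), t; split; first by move=> y [/tP[]].
split.
- by move=> y Gy; split; [exact: Gh|move=> tyc; apply: tc; exists y].
- apply: full_sub (fullD Oinf (finite_set1 (h c)) hfull) => y [hy yc]; split=> //= tyc.
  by apply: yc; have [_ <-] := tP y hy; rewrite tyc.
- apply: card_le_lt_trans (_ : defect h `|` [set h c] #< _).
    apply: subset_card_le => y nAy; have [hy|nhy] := pselect (range h y); last by left.
    right => /=; have [_ <-] := tP y hy; congr h.
    by apply: contrapT => tyc; apply: nAy.
  by apply: card_setU_lt => //; apply: finite_card_lt.
- by right => /(_ _ Gc)[y [_ yc] /yc].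
Qed.

(** [h] is injective on [Gamma], so some transversal contains [Gamma].  If [h]
    does not map [Gamma] onto itself, let [c] be a point of [Gamma] missed by this
    image; discarding the at most one point of the transversal above [c] makes
    the image of the transversal miss [c]. *)
Lemma F2_escape U (nu : set U) Gamma h : finite_set Gamma -> infinite_set nu ->
  ~ F2 Gamma nu h ->
  exists A, (forall x y, A x -> A y -> h x = h y -> x = y) /\ escapes nu Gamma A h.
Proof.
move=> Gfin nuinf nF.
have hfull : full (range h) by apply: full_range => sh; apply: nF; right.
have hnu : collapse h #< nu.
  by apply/card_ltNge => C; apply: nF; left; apply: Or31.
have hinj : forall x y, Gamma x -> Gamma y -> h x = h y -> x = y.
  apply: finite_card_image_inj => //; apply/card_nltge => sG.
  by apply: nF; left; apply: Or32.
have [T hT GT] := transversal_above Oinf hinj.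
have Tfull : full T.
  by apply: (card_le_trans hfull); exact: card_eq_leR (transversal_image hT).
have Tnu : ~` T #< nu := card_le_lt_trans (card_eq_leL (collapseP hT)) hnu.
have [hG|hG] := pselect (h @` Gamma = Gamma).
  exists T; split; first by move=> x y; exact: transversal_injP.
  split=> //; left; have [_ ->] := hT.
  by apply/card_nltge => c; apply: nF; left; apply: Or33.
have [c [Gc hc]] : exists c, Gamma c /\ ~ (h @` Gamma) c.
  apply: contrapT => nc; apply: hG; apply/esym.
  apply: finite_sub_eq; [exact: finite_image| |exact: card_image_le].
  by move=> c Gc; apply: contrapT => tc; apply: nc; exists c.
pose R := T `&` [set x | h x = c].
have Rfin : finite_set R.
  apply: card_le_finite (finite_set1 c).
  apply: (@set_inj_card_le _ _ _ _ h) => [x []//|x y [Tx _] [Ty _]].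
  exact: transversal_injP hT Tx Ty.
exists (T `\` R); split; first by move=> x y [Tx _] [Ty _]; exact: transversal_injP hT Tx Ty.
split.
- by move=> x Gx; split; [exact: GT|move=> [_ hxc]; apply: hc; exists x].
- exact: fullD.
- apply: card_le_lt_trans (_ : ~` T `|` R #< _).
    apply: subset_card_le => x nx; have [Tx|nTx] := pselect (T x); last by left.
    by right; apply: contrapT => nR; apply: nx.
  by apply: card_setU_lt => //; exact: finite_card_lt.
- by right => /(_ _ Gc)[x [Tx nRx] hxc]; apply: nRx.
Qed.

(** * Maximality of [F1] and [F2] *)

Lemma maximal_of_factorisation (M : set (Omega -> Omega)) :
  subsemigroup (mulmap Omega) M ->
  M <> [set: Omega -> Omega] ->
  (forall h k, ~ M h -> ~ M k -> exists a b,
     [/\ M a, M b & k = mulmap _ (mulmap _ a h) b]) ->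
  maximal_subsemigroup (mulmap Omega) M.
Proof.
move=> Msub MT fact; split=> // h nMh; apply/seteqP; split=> // k _ N [Nsub NM].
have [Mk|nMk] := pselect (M k); first by apply: NM; left.
have [a [b [Ma Mb ->]]] := fact h k nMh nMk.
apply: (Nsub); last by apply: NM; left.
by apply: (Nsub); apply: NM; [left|right].
Qed.

(** Identify the range of [k] with [A] by a bijection fixing [Gamma].  Then [a]
    follows [k] by this identification and by the section [t], and [b] is the
    inverse identification; [a] inherits from [t] either a large defect or a
    point of [Gamma] outside its range, and [b] keeps [Gamma] apart from its
    complement and is injective on [A]. *)
Lemma F1_factorisation U (mu : set U) Gamma h k :
  finite_set Gamma -> infinite_set mu -> ~ F1 Gamma mu h -> ~ F1 Gamma mu k ->
  exists a b, [/\ F1 Gamma mu a, F1 Gamma mu b & k = mulmap _ (mulmap _ a h) b].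
Proof.
move=> Gfin muinf nFh nFk.
have [A [t [ht [GA Afull Amu tA]]]] := F1_escape Gfin muinf nFh.
have kfull : full (range k) by apply: full_range => sk; apply: nFk; right.
have Gk : Gamma `<=` range k by apply: contrapT => nG; apply: nFk; left; apply: Or32.
have [phi [psi [phiA phiK psiK phiG]]] := full_bij_fixing Oinf Gfin GA Afull.
have [rho [sig [rhoA rhoK sigK rhoG]]] := full_bij_fixing Oinf Gfin Gk kfull.
have [w [kw nGw]] : (range k `\` Gamma) !=set0.
  by apply: infinite_setN0; exact: infinite_card_le Oinf (fullD Oinf Gfin kfull).
pose b y := if pselect (A y) is left _ then rho (psi y) else w.
have bA y : A y -> b y = rho (psi y) by rewrite /b; case: pselect.
have bN y : ~ A y -> b y = w by rewrite /b; case: pselect.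
exists (fun x => t (phi (sig (k x)))), b; split; last 1 first.
- apply: funext => x; rewrite /mulmap ht// bA// phiK sigK//; by exists x.
- have range_a : range (fun x => t (phi (sig (k x)))) `<=` t @` A.
    by move=> _ [x _ <-]; exists (phi (sig (k x))).
  left; case: tA => [muA|nG]; [apply: Or31|apply: Or32].
    by apply: (card_le_trans muA); apply: subset_card_le; exact: subsetC.
  by move=> GG; apply: nG; exact: subset_trans range_a.
- left; apply: Or33; split.
    move=> y /=; have [Ay|nAy] := pselect (A y); last by rewrite bN.
    rewrite bA// => G; have e : psi y = rho (psi y).
      by rewrite -[RHS]rhoK -[LHS]rhoK (rhoG _ G) !rhoK.
    by move: (G); rewrite -e => G'; rewrite -(psiK y Ay) phiG.
  have bT : transversal b A; last first.
    exact: card_le_lt_trans (card_eq_leR (collapseP bT)) Amu.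
  split.
    move=> x y /set_mem Ax /set_mem Ay; rewrite !bA// => /(can_inj rhoK) e.
    by rewrite -(psiK x Ax) e psiK.
  apply/seteqP; split=> [_ [x Ax <-]|_ [x _ <-]]; first by exists x.
  have [Ax|nAx] := pselect (A x); first by exists x.
  by exists (phi (sig w)) => //; rewrite (bN _ nAx) bA ?phiK ?sigK.
Qed.

(** Let [a] be a bijection of [Omega] onto [A] fixing [Gamma].  On the image of
    [A] under [h] the values of [b] are forced by [k]; elsewhere [b] is constant,
    and the constant decides why [b] lies in the semigroup.  It is a value of [k]
    if the image has a large complement, so that [b] collapses the latter; the
    value of [b] at a second point of [Gamma] if the image misses a point of
    [Gamma]; and that point itself if [Gamma] has no second point, where the
    assumption on [nu] makes the condition on the defect automatic. *)
Lemma F2_factorisation U (nu : set U) Gamma h k :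
  finite_set Gamma -> infinite_set nu ->
  (Gamma #= `I_1 /\ nu #= succ_card Omega) \/
    (`I_2 #<= Gamma /\ nu #<= succ_card Omega) ->
  ~ F2 Gamma nu h -> exists a b,
    [/\ F2 Gamma nu a, F2 Gamma nu b & k = mulmap _ (mulmap _ a h) b].
Proof.
move=> Gfin nuinf Gnu nFh.
have [A [hinj [GA Afull Anu hA]]] := F2_escape Gfin nuinf nFh.
have [phi [psi [phiA phiK psiK phiG]]] := full_bij_fixing Oinf Gfin GA Afull.
have [w _] := infinite_setN0 Oinf.
have /choice[r rP] y : exists x, (h @` A) y -> A x /\ h x = y.
  have [[x Ax <-]|ny] := pselect ((h @` A) y); first by exists x.
  by exists y.
have rh x : A x -> r (h x) = x.
  move=> Ax; have [|Ar e] := rP (h x); first by exists x.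
  exact: hinj.
pose b c y := if pselect ((h @` A) y) is left _ then k (psi (r y)) else c.
have bA c y : (h @` A) y -> b c y = k (psi (r y)) by rewrite /b; case: pselect.
have bN c y : ~ (h @` A) y -> b c y = c by rewrite /b; case: pselect.
have Fphi : F2 Gamma nu phi.
  left; apply: Or33; split.
    apply/seteqP; split=> [_ [x Gx <-]|x Gx]; first by rewrite phiG.
    by exists x => //; exact: phiG.
  apply: card_le_lt_trans Anu; apply: subset_card_le => y ny Ay; apply: ny.
  by exists (psi y) => //; exact: psiK.
have kE c : k = mulmap _ (mulmap _ phi h) (b c).
  apply: funext => x; rewrite /mulmap bA; last by exists (phi x).
  by rewrite rh// phiK.
suff [c Fb] : exists c, F2 Gamma nu (b c) by exists phi, (b c); split.
case: hA => [nuA|/existsNP[c /not_implyP[Gc nhc]]].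
  exists (k w); left; apply: Or31.
  have [//|_ [x _ <-]|T [bT _ TA]] :=
      @transversal_between _ Oinf (b (k w)) set0 (h @` A) _ (@sub0set _ _).
    have [hx|nhx] := pselect ((h @` A) x); first by exists x.
    exists (h (phi w)); first by exists (phi w).
    by rewrite (bN _ _ nhx) bA ?rh ?phiK//; exists (phi w).
  apply: card_le_trans (card_eq_leL (collapseP bT)).
  by apply: (card_le_trans nuA); apply: subset_card_le; exact: subsetC.
have [[d Gd dc]|nd] := pselect (exists2 d, Gamma d & d <> c).
  exists (b w d); left; apply: Or32; apply/card_ltNge.
  move=> /(finite_card_image_inj Gfin) /(_ d c Gd Gc) dc'; apply: dc; apply: dc'.
  rewrite (bN _ _ nhc); have [hd|nhd] := pselect ((h @` A) d); first by rewrite !bA.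
  by rewrite (bN _ _ nhd).
have GE : Gamma = [set c].
  apply/seteqP; split=> [d Gd|_ -> //]; apply: contrapT => dc.
  by apply: nd; exists d.
exists c; left; apply: Or33; split.
  by rewrite GE image_set1 bN.
case: Gnu => [[_ nuE]|[G2 _]].
  apply: card_le_lt_trans (card_leT _) _.
  apply: card_lt_le_trans (card_eq_leR nuE); exact: (succ_cardP Omega).1.
have : `I_2 #<= `I_1.
  by apply: (card_le_trans G2); rewrite GE; apply: card_eq_leL; exact: card_set1.
by rewrite card_le_II.
Qed.

Lemma swap_bijective (a b : Omega) : exists p : Omega -> Omega,
  [/\ bijective p, p a = b & p b = a].
Proof.
pose p x := if pselect (x = a) then b else if pselect (x = b) then a else x.
have pa : p a = b by rewrite /p; case: pselect.
have pb : p b = a by rewrite /p; case: pselect => [ba|? /=]; last by case: pselect.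
have pp x : x <> a -> x <> b -> p x = x.
  by move=> xa xb; rewrite /p; case: pselect => [//|? /=]; case: pselect.
have pK : cancel p p.
  move=> x; have [->|xa] := pselect (x = a); first by rewrite pa pb.
  have [->|xb] := pselect (x = b); first by rewrite pb pa.
  by rewrite !pp.
by exists p; split=> //; exists p.
Qed.

Lemma bijective_range f : bijective f -> range f = setT.
Proof. by move=> [g _ gK]; apply/seteqP; split=> // y _; exists (g y). Qed.

Lemma defect_bijective f : bijective f -> defect f = set0.
Proof. by move=> /bijective_range fT; rewrite /defect fT setCT. Qed.

Lemma collapse_injective f : injective f -> collapse f #<= @set0 Omega.
Proof.
move=> finj; rewrite -setCT; apply: card_eq_leR; apply: collapseP.
by split=> // x y _ _ /finj.
Qed.

Lemma range_injective_full f : injective f -> full (range f).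
Proof. by move=> finj; apply: card_eq_leR; apply: card_image_inj => x y _ _ /finj. Qed.

Lemma nle_set0 U V (mu : set U) (A : set V) :
  infinite_set mu -> A #<= @set0 Omega -> ~ (mu #<= A).
Proof.
move=> muinf A0 muA; apply: muinf.
by apply: card_le_finite (finite_set0 Omega); exact: card_le_trans A0.
Qed.

(** Exchange a point of [Gamma] with a point outside it. *)
Lemma Sym_not_sub_F1 U (mu : set U) Gamma : finite_set Gamma -> infinite_set mu ->
  Gamma !=set0 -> exists2 p, Sym Omega p & ~ F1 Gamma mu p.
Proof.
move=> Gfin muinf [c Gc].
have [d nGd] : exists d, ~ Gamma d.
  apply: contrapT => nd; apply: Oinf; apply: sub_finite_set Gfin => d _.
  by apply: contrapT => nGd; apply: nd; exists d.
have [p [pbij pc pd]] := swap_bijective c d; exists p => // -[[]|].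
- by rewrite defect_bijective //; apply: nle_set0.
- by apply; rewrite bijective_range.
- by move=> [/(_ d)] /=; rewrite pd => /(_ Gc).
- by move=> [_]; apply; apply: range_injective_full; exact: bij_inj.
Qed.

Lemma Sym_not_sub_F2 U (nu : set U) Gamma : finite_set Gamma -> infinite_set nu ->
  Gamma !=set0 -> exists2 p, Sym Omega p & ~ F2 Gamma nu p.
Proof.
move=> Gfin nuinf [c Gc].
have [d nGd] : exists d, ~ Gamma d.
  apply: contrapT => nd; apply: Oinf; apply: sub_finite_set Gfin => d _.
  by apply: contrapT => nGd; apply: nd; exists d.
have [p [pbij pc pd]] := swap_bijective c d.
have pinj := bij_inj pbij; exists p => // -[[]|].
- by apply: nle_set0 => //; exact: collapse_injective.
- by move=> [_]; apply; apply: card_eq_leR; apply: card_image_inj => x y _ _ /pinj.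
- by move=> [pG _]; apply: nGd; rewrite -pG; exists c.
- by move=> [_]; apply; apply: range_injective_full.
Qed.

Lemma pointwise_stabiliser_F1 U (mu : set U) Gamma Sigma : infinite_set mu ->
  Gamma `<=` Sigma -> pointwise_stabiliser Sigma `<=` F1 Gamma mu.
Proof.
move=> muinf GS p [pbij pS]; left; apply: Or33; split.
  move=> x /= Gpx; have := pS _ (GS _ Gpx) => /(bij_inj pbij) e.
  by rewrite -e.
apply: card_le_lt_trans (collapse_injective (bij_inj pbij)) _.
exact: finite_card_lt.
Qed.

Lemma pointwise_stabiliser_F2 U (nu : set U) Gamma Sigma : infinite_set nu ->
  Gamma `<=` Sigma -> pointwise_stabiliser Sigma `<=` F2 Gamma nu.
Proof.
move=> nuinf GS p [pbij pS]; left; apply: Or33; split.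
  by apply/seteqP; split=> [_ [x /[dup] Gx /GS /pS -> <-]//|x Gx]; exists x => //; apply/pS/GS.
by rewrite defect_bijective//; exact: finite_card_lt.
Qed.

Lemma F1_maximal U (mu : set U) Gamma : finite_set Gamma -> infinite_set mu ->
  Gamma !=set0 -> maximal_subsemigroup (mulmap Omega) (F1 Gamma mu).
Proof.
move=> Gfin muinf G0; apply: maximal_of_factorisation.
- exact: F1_subsemigroup.
- move=> FT; have [p _] := Sym_not_sub_F1 Gfin muinf G0; by rewrite FT; apply.
- by move=> h k; exact: F1_factorisation.
Qed.

Lemma F2_maximal U (nu : set U) Gamma : finite_set Gamma -> infinite_set nu ->
  (Gamma #= `I_1 /\ nu #= succ_card Omega) \/
    (`I_2 #<= Gamma /\ nu #<= succ_card Omega) ->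
  Gamma !=set0 -> maximal_subsemigroup (mulmap Omega) (F2 Gamma nu).
Proof.
move=> Gfin nuinf Gnu G0; apply: maximal_of_factorisation.
- exact: F2_subsemigroup.
- move=> FT; have [p _] := Sym_not_sub_F2 Gfin nuinf G0; by rewrite FT; apply.
- by move=> h k nFh _; exact: F2_factorisation.
Qed.

End Semigroups.

(** * A total injection avoiding [Sigma] and leaving out a full set *)

Lemma card_le_setD1 T U (W : set T) (D : set U) (x : T) (y : U) :
  ~ W x -> x |` W #<= D -> W #<= D `\ y.
Proof.
move=> nWx /(card_le_fun y)[f [fD finj]].
have Wx w : W w -> (x |` W) w by right.
have xx : (x |` W) x by left.
pose g w := if pselect (f w = y) is left _ then f x else f w.
apply: (@set_inj_card_le _ _ _ _ g) => [w Ww|w v Ww Wv]; rewrite /g.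
  case: pselect => [fwy|fwy]; last by split; [exact/fD/Wx|].
  split=> [|fxy]; first exact: fD.
  by apply: nWx; rewrite (finj x w)// ?fwy//; exact: Wx.
have fx u : W u -> f x <> f u.
  by move=> Wu /(finj _ _ xx (Wx _ Wu)) xu; apply: nWx; rewrite xu.
case: pselect => fwy; case: pselect => fvy.
- by move=> _; apply: finj; [exact: Wx|exact: Wx|rewrite fwy fvy].
- by move=> /(fx _ Wv).
- by move=> /esym /(fx _ Ww).
- by apply: finj; exact: Wx.
Qed.

Lemma card_le_setD_finite T (F C D : set T) : finite_set F -> C `&` F = set0 ->
  F `|` C #<= D -> C #<= D `\` F.
Proof.
move=> Ffin; elim/finite_set_ind: F / Ffin D => [|x F nFx IH] D CF.
  by rewrite set0U setD0.
have nC y : C y -> ~ (x |` F) y by move=> Cy Fy; have : set0 y by rewrite -CF.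
rewrite -setUA => /(card_le_setD1 x) xFC.
rewrite -setDDl; apply: IH; last first.
  by apply: xFC => -[//|Cx]; apply: (nC x) => //; left.
by apply/seteqP; split=> // y [Cy Fy]; case: (nC y Cy); right.
Qed.

(** [P A p] says that the restriction of [p] to [A] belongs to a class of partial
    injections.  Stating the argument for an abstract class lets it serve for the
    restrictions of elements of a semigroup as well as for their sections, where
    the order of products is reversed. *)
Section PartialInjections.
Variable Omega : Type.
Hypothesis Oinf : infinite_set [set: Omega].
Variable Sigma : set Omega.
Hypothesis Sfin : finite_set Sigma.
Variable P : set Omega -> (Omega -> Omega) -> Prop.
Implicit Types (A B C F : set Omega) (f p q : Omega -> Omega).
Hypothesis Pinj : forall A p, P A p ->
  forall x y, A x -> A y -> p x = p y -> x = y.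
Hypothesis Pmul : forall A B p r, P A p -> P B r -> p @` A `<=` B ->
  P A (mulmap Omega p r).
Hypothesis Pstab : forall q, pointwise_stabiliser Sigma q -> P setT q.
Hypothesis Pbase : exists p, P setT p /\ range p <> setT.
Hypothesis Pescape : forall (Gamma nu : set Omega), Gamma `<=` Sigma ->
  infinite_set nu -> exists A p, P A p /\ escapes nu Gamma A p.
Hypothesis Pescape_succ : forall (Gamma : set Omega), Gamma `<=` Sigma ->
  Gamma !=set0 -> exists A p, P A p /\ escapes (succ_card Omega) Gamma A p.

Let tot_inj p : P setT p -> injective p.
Proof. by move=> Pp x y; exact: Pinj Pp _ _ I I. Qed.

Section Minimal.
Variable f0 : Omega -> Omega.
Hypothesis Pf0 : P setT f0.
Variable y0 : Omega.
Hypothesis f0y0 : ~ range f0 y0.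
Let Gamma := Sigma `&` range f0.
Hypothesis f0min : forall f, P setT f -> range f <> setT ->
  Gamma #<= Sigma `&` range f.

(** The total members available for further compositions.  By minimality of
    [Gamma] their ranges meet [Sigma] exactly in [Gamma]. *)
Definition nice f := [/\ P setT f, range f <> setT & Sigma `&` range f `<=` Gamma].

Let GS : Gamma `<=` Sigma. Proof. by move=> x []. Qed.

Let Gfin : finite_set Gamma. Proof. exact: sub_finite_set GS Sfin. Qed.

Let f0inj : injective f0. Proof. exact: tot_inj. Qed.

Let nice_Gamma f : nice f -> Gamma `<=` range f.
Proof.
move=> [Pf fT fG]; have <- := finite_sub_eq Gfin fG (f0min Pf fT).
by move=> x [].
Qed.

(** Since [f0] comes last, whatever stands before it, the range stays inside that
    of [f0]. *)
Let nice_mul p : P setT p -> nice (mulmap _ p f0).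
Proof.
move=> Pp; have sub : range (mulmap _ p f0) `<=` range f0.
  by move=> _ [x _ <-]; exists (p x).
split.
- by apply: Pmul Pp Pf0 _.
- by move=> pT; apply: f0y0; apply: sub; rewrite pT.
- by move=> x [Sx /sub].
Qed.

Let nice_f0 : nice f0.
Proof. by split=> // f0T; apply: f0y0; rewrite f0T. Qed.

(** Composing with [f0] adds to the complement of the range of [f], carried over
    by [f0], the point [y0] that [f0] misses. *)
Let grow1 f C x : nice f -> C #<= ~` range f ->
  exists2 f', nice f' & x |` C #<= ~` range f'.
Proof.
move=> nf /(card_le_fun x)[phi [phif phiinj]]; have [Pf _ _] := nf.
exists (mulmap _ f f0); first exact: nice_mul.
pose g z := if pselect (z = x) is left _ then y0 else f0 (phi z).
apply: (@set_inj_card_le _ _ _ _ g) => [z|z t]; rewrite /g.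
  case: pselect => [_ _ [u _ e]|zx [//|Cz] [u _ /f0inj e]].
    by apply: f0y0; exists (f u).
  by apply: (phif _ Cz); exists u.
case: pselect => [->|zx]; case: pselect => [->//|tx].
- by move=> _ _ e; case: f0y0; exists (phi t).
- by move=> _ _ e; case: f0y0; exists (phi z).
- by move=> [//|Cz] [//|Ct] /f0inj; exact: phiinj.
Qed.

Let grow F f C : finite_set F -> nice f -> C #<= ~` range f ->
  exists2 f', nice f' & F `|` C #<= ~` range f'.
Proof.
move=> Ffin nf Cf; elim/finite_set_ind: F / Ffin => [|x F _ [f' nf' FC]].
  by exists f; rewrite ?set0U.
by have [f'' nf'' xFC] := grow1 x nf' FC; exists f''; rewrite -?setUA.
Qed.

(** A permutation [r] fixing [Sigma] pointwise can move the range of [f] into [B]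
    as soon as the complement of that range has room for [Sigma] and for the
    complement of [B].  The inverse [q] of [r] is built by extending an injection
    of the complement of [B] into that of the range; the points of [Sigma] are
    accounted for separately because [q] must fix them. *)
Let avoid f B : nice f -> Gamma `<=` B -> full B -> Sigma `|` ~` B #<= ~` range f ->
  exists2 f', P setT f' & range f' `<=` B.
Proof.
move=> nf GB Bfull SBf; have [Pf _ fG] := nf.
pose C := ~` B `\` Sigma.
have : C #<= ~` range f `\` Sigma.
  apply: card_le_setD_finite => //; first by rewrite /C setDE -setIA setICl setI0.
  by apply: card_le_trans SBf; apply: subset_card_le => x [|[]]; [left|right].
move=> /(card_le_fun y0)[phi [phif phiinj]].
pose theta z := if pselect (Sigma z) is left _ then z else phi z.
have thS z : Sigma z -> theta z = z by rewrite /theta; case: pselect.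
have thC z : C z -> theta z = phi z by rewrite /theta; case: pselect => // Sz [].
have [| | |q [r [qr rq qth]]] := @bijective_extension _ Oinf (Sigma `|` C) theta.
- move=> x y [Sx|Cx] [Sy|Cy].
  + by rewrite !thS.
  + by rewrite thS// thC// => e; case: (phif y Cy) => _ nS; case: nS; rewrite -e.
  + by rewrite thC// thS// => e; case: (phif x Cx) => _ nS; case: nS; rewrite e.
  + by rewrite !thC//; exact: phiinj.
- apply: full_sub (fullD Oinf Sfin Bfull) => x [Bx nSx] [//|[nBx _]].
  exact: nBx.
- apply: full_sub (fullD Oinf Sfin (range_injective_full (tot_inj Pf))) => x [fx nSx].
  move=> [z [Sz|Cz]]; first by rewrite thS// => zx; apply: nSx; rewrite -zx.
  by rewrite thC// => zx; case: (phif z Cz) => + _; rewrite zx.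
have Gr : pointwise_stabiliser Sigma r.
  split; first by exists q.
  by move=> x Sx; rewrite -{1}(thS x Sx) -qth ?qr//; left.
exists (mulmap _ f r); first by apply: Pmul Pf (Pstab Gr) _.
move=> _ [x _ <-]; rewrite /mulmap; apply: contrapT => nB.
have [Sr|nSr] := pselect (Sigma (r (f x))).
  apply: nB; apply: GB; apply: fG; split=> //; exists x => //.
  by rewrite -[LHS]rq qth ?thS//; left.
have Cr : C (r (f x)) by [].
have := phif _ Cr; rewrite -thC// -qth; last by right.
by rewrite rq => -[+ _]; apply; exists x.
Qed.

(** A point [z] outside [Gamma] sent into [Gamma] by [f0] could be avoided by some
    [f'], and then [f' f0] would meet [Sigma] in less than [Gamma]. *)
Let f0_Gamma x : Gamma x -> Gamma (f0 x).
Proof.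
suff GE : Gamma = f0 @` Gamma by move=> Gx; rewrite GE; exists x.
apply: finite_sub_eq; [exact: finite_image| |exact: card_image_le].
move=> c Gc; have [_ [z _ zc]] := Gc; exists z => //; apply: contrapT => nGz.
have fin : finite_set (Sigma `|` [set z]) by rewrite finite_setU; split.
have [f nf] := grow fin nice_f0 (card_ge0 Omega (~` range f0)).
rewrite setU0 => Szf; have [| | |f' Pf' f'z] := @avoid f (~` [set z]) nf.
- by move=> u Gu uz; apply: nGz; rewrite -uz.
- apply: full_sub (fullD Oinf (finite_set1 z) (card_lexx setT)) => u [_ uz] //.
- by rewrite setCK.
have [u _ uc] := nice_Gamma (nice_mul Pf') Gc.
apply: (f'z (f' u)); first by exists u.
by apply: f0inj; rewrite zc.
Qed.

(** If [c] in [Gamma] is missed by [p] on [A], then [f' p f0] misses [f0 c], which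
    is a point of [Gamma] too: this contradicts minimality. *)
Let no_miss f A p : nice f -> P A p -> Gamma `<=` A -> full A ->
  Sigma `|` ~` A #<= ~` range f -> Gamma `<=` p @` A.
Proof.
move=> nf Pp GA Afull SAf c Gc.
have [f' Pf' f'A] := avoid nf GA Afull SAf.
have Pf'p := Pmul Pf' Pp f'A.
have [u _ /f0inj uc] := nice_Gamma (nice_mul Pf'p) (f0_Gamma Gc).
by exists (f' u) => //; apply: f'A; exists u.
Qed.

(** Let [N] be the least infinite cardinal that the complements of ranges fail to
    reach.  A member escaping from ([Gamma], [N]) is defined outside a set smaller
    than [N], and some range leaves enough room to avoid that set; the composite
    then has a complement of cardinal at least [N]. *)
Let nice_full : exists2 f, nice f & full (~` range f).
Proof.
apply: contrapT => nfull.
pose Q (N : set Omega) := infinite_set N /\ forall f, nice f -> ~ (N #<= ~` range f).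
have QT : Q setT by split=> // f nf fT; apply: nfull; exists f.
have [[N [Ninf Nf]] Nmin] := card_min (fun N : {N | Q N} => sval N) (exist _ _ QT).
have [A [p [Pp [GA Afull AN pA]]]] := Pescape GS Ninf.
have [f nf Af] : exists2 f, nice f & ~` A #<= ~` range f.
  have [Afin|Ainf] := pselect (finite_set (~` A)).
    have [f nf] := grow Afin nice_f0 (card_ge0 Omega (~` range f0)).
    by rewrite setU0; exists f.
  apply: contrapT => nA; have QA : Q (~` A).
    by split=> // f nf Af; apply: nA; exists f.
  by have [_] := AN; apply; exact: (Nmin (exist _ _ QA)).
have [f1 nf1 SAf1] := grow Sfin nf Af.
case: pA => [NpA|]; last by apply; exact: no_miss SAf1.
have [f' Pf' f'A] := avoid nf1 GA Afull SAf1.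
have Pf'p := Pmul Pf' Pp f'A.
apply: (Nf _ (nice_mul Pf'p)); apply: (card_le_trans NpA).
apply: (@set_inj_card_le _ _ _ _ f0) => [x npx [u _ /f0inj ux]|x y _ _ /f0inj//].
by apply: npx; exists (f' u) => //; apply: f'A; exists u.
Qed.

Lemma full_escape_of_minimal : exists p,
  [/\ P setT p, forall x, ~ Sigma (p x) & full (~` range p)].
Proof.
have [f nf ffull] := nice_full; have [Pf _ fG] := nf.
exists f; split=> // x Sfx; have Gfx : Gamma (f x) by apply: fG; split=> //; exists x.
have [|A [p [Pp [GA Afull _ pA]]]] := Pescape_succ GS; first by exists (f x).
case: pA => [succA|].
  have [_] := (succ_cardP Omega).1; apply; apply: card_le_trans succA _.
  exact: card_leT.
apply; apply: (no_miss nf) => //; apply: card_le_trans ffull; exact: card_leT.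
Qed.

End Minimal.

Lemma full_escape : exists p,
  [/\ P setT p, forall x, ~ Sigma (p x) & full (~` range p)].
Proof.
have [p1 p1P] := Pbase.
have [[f0 [Pf0 f0T]] fmin] := card_min
  (fun f : {f | P setT f /\ range f <> setT} => Sigma `&` range (sval f))
  (exist _ _ p1P).
have [y0 f0y0] : exists y, ~ range f0 y.
  apply: contrapT => ny; apply: (f0T); apply/seteqP; split=> // y _.
  by apply: contrapT => nfy; apply: ny; exists y.
apply: (full_escape_of_minimal Pf0 f0y0) => f Pf fT.
exact: (fmin (exist _ f (conj Pf fT))).
Qed.

End PartialInjections.

(** * Maximal subsemigroups that are not of the listed form *)

Lemma maximal_not_sub S (op : S -> S -> S) (M N : set S) :
  maximal_subsemigroup op M -> subsemigroup op N -> N <> setT -> M <> N ->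
  exists2 s, M s & ~ N s.
Proof.
move=> [Msub MT Mmax] Nsub NT MN; apply: contrapT => nMN.
have {}nMN : M `<=` N.
  by move=> s Ms; apply: contrapT => nNs; apply: nMN; exists s.
have [s [Ns nMs]] : exists s, N s /\ ~ M s.
  apply: contrapT => nNM; apply: MN; apply/seteqP; split=> // s Ns.
  by apply: contrapT => nMs; apply: nNM; exists s.
apply: NT; apply/seteqP; split=> // t _.
have : generated op (M `|` [set s]) t by rewrite Mmax.
by apply; split=> // u [/nMN|->].
Qed.

Section Converse.
Variable Omega : Type.
Hypothesis Oinf : infinite_set [set: Omega].
Variable Sigma : set Omega.
Hypothesis Sfin : finite_set Sigma.
Variable M : set (Omega -> Omega).
Hypothesis Mmax : maximal_subsemigroup (mulmap Omega) M.
Hypothesis MSigma : pointwise_stabiliser Sigma `<=` M.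
Hypothesis nSymM : ~ (Sym Omega `<=` M).

Let Mmul f g : M f -> M g -> M (mulmap Omega f g).
Proof. by have [Msub _ _] := Mmax; exact: Msub. Qed.

Let not_sub N : subsemigroup (mulmap Omega) N -> Sym Omega `<=` N -> N <> setT ->
  exists2 h, M h & ~ N h.
Proof.
move=> Nsub SymN NT; apply: (maximal_not_sub Mmax) => // MN.
by apply: nSymM; rewrite MN.
Qed.

Let le_full (nu A : set Omega) : full A -> nu #<= A.
Proof. by apply: card_le_trans; exact: card_leT. Qed.

Let exists_surj : exists e g : Omega -> Omega, [/\ cancel e g & full (~` range e)].
Proof.
have [e [einj efull]] := exists_co_full_injection Oinf; have [w _] := infinite_setN0 Oinf.
have /choice[g gP] y : exists x, range e y -> e x = y.
  by have [[x _ <-]|ny] := pselect (range e y); [exists x|exists w].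
by exists e, g; split=> // x; apply: einj; apply: gP; exists x.
Qed.

(** Otherwise [M] would lie in the proper semigroup of maps that are surjective or not
    injective, which contains [Sym]. *)
Lemma exists_injective_nonsurjective :
  exists h, [/\ M h, injective h & range h <> setT].
Proof.
have [|p pS|NT|h Mh nN] := @not_sub [set f | injective f -> range f = setT].
- move=> f g /= Nf Ng fginj; have finj : injective f.
    by move=> x y xy; apply: fginj; rewrite /mulmap xy.
  have fT := Nf finj; have ginj : injective g.
    move=> x y; have [[u _ <-] [v _ <-]] : range f x /\ range f y by rewrite fT.
    by move=> /fginj ->.
  apply/seteqP; split=> // z _; have [y _ <-] : range g z by rewrite Ng.
  by have [x _ <-] : range f y by [rewrite fT]; exists x.
- by move=> _; exact: bijective_range.
- have [e [g [eg efull]]] := exists_surj.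
  have : [set f | injective f -> range f = setT] e by rewrite NT.
  move=> /(_ (can_inj eg)) eT; move: efull; rewrite /full eT setCT.
  by rewrite card_le0 => /eqP T0; apply: Oinf; rewrite T0.
- by move/not_implyP: nN => [hinj hT]; exists h.
Qed.

(** Dually, [M] does not lie in the proper semigroup of maps that are injective or not
    surjective. *)
Lemma exists_surjective_noninjective :
  exists h, [/\ M h, range h = setT & ~ injective h].
Proof.
have [|p pS|NT|h Mh nN] := @not_sub [set f | range f = setT -> injective f].
- move=> f g /= Nf Ng fgT; have gT : range g = setT.
    apply/seteqP; split=> // z _; have [x _ <-] : range (mulmap _ f g) z by rewrite fgT.
    by exists (f x).
  have ginj := Ng gT; have fT : range f = setT.
    apply/seteqP; split=> // y _.
    have [x _ /ginj <-] : range (mulmap _ f g) (g y) by rewrite fgT.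
    by exists x.
  by move=> x y /ginj; exact: Nf.
- by move=> _; exact: bij_inj.
- have [e [g [eg efull]]] := exists_surj.
  have : [set f | range f = setT -> injective f] g by rewrite NT.
  have gT : range g = setT by apply/seteqP; split=> // x _; exists (e x).
  move=> /(_ gT) ginj; have [y ney] : (~` range e) !=set0.
    by apply: infinite_setN0; exact: infinite_card_le efull.
  by apply: ney; exists (g y) => //; apply: ginj; rewrite eg.
- by move/not_implyP: nN => [hinj hT]; exists h.
Qed.

(** For [mu] at most the cardinal of [Omega], the semigroup [F1 set0 mu] is proper
    and contains [Sym]. *)
Lemma exists_not_F1_set0 (mu : set Omega) : infinite_set mu ->
  exists2 h, M h & ~ F1 set0 mu h.
Proof.
move=> muinf; apply: not_sub; first exact: F1_subsemigroup.
  move=> p pbij; left; apply: Or33; split=> //.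
  apply: card_le_lt_trans (collapse_injective (bij_inj pbij)) _.
  exact: finite_card_lt.
have [e [g [eg efull]]] := exists_surj => NT.
have gT : range g = setT by apply/seteqP; split=> // x _; exists (e x).
have : F1 set0 mu g by rewrite NT.
have geT : Defs.transversal g (range e).
  split; first by move=> _ _ /set_mem[x _ <-] /set_mem[y _ <-]; rewrite !eg => ->.
  by rewrite gT; apply/seteqP; split=> // x _; exists (e x); rewrite ?eg//; exists x.
move=> [[|nsub|[_]]|].
- by rewrite /defect gT setCT; exact: nle_set0.
- by case: nsub.
- move=> [_]; apply; apply: card_le_trans (card_eq_leL (collapseP geT)).
  exact: le_full.
- by move=> [_]; apply; rewrite gT.
Qed.

Lemma exists_not_F2_set0 (nu : set Omega) : infinite_set nu ->
  exists2 h, M h & ~ F2 set0 nu h.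
Proof.
move=> nuinf; apply: not_sub; first exact: F2_subsemigroup.
  move=> p pbij; left; apply: Or33; rewrite image_set0 defect_bijective//; split=> //.
  exact: finite_card_lt.
have [e [g [eg efull]]] := exists_surj => NT.
have : F2 set0 nu e by rewrite NT.
have einj := can_inj eg; move=> [[||[_]]|].
- by apply: nle_set0 => //; exact: collapse_injective.
- by rewrite image_set0 => -[].
- by move=> [_]; apply; exact: le_full.
- by move=> [_]; apply; exact: range_injective_full.
Qed.

Lemma not_card_ge2 T (A : set T) : ~ (`I_2 #<= A) ->
  forall x y, A x -> A y -> x = y.
Proof.
move=> nA x y Ax Ay; apply: contrapT => xy; apply: nA.
apply: (@set_inj_card_le _ _ _ _ (fun i => if i is 0 then x else y)).
  by move=> [|i].
by move=> [|[|i]] [|[|j]] //= _ _ e; case: xy; rewrite e.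
Qed.

(** No image of a set of at most one point is smaller than it, so for such [Gamma]
    the second kind of members of [F2] is absent.  As [F2 set0 nu] contains [Sym],
    this is why a point and a cardinal [nu] up to that of [Omega] do not occur
    together in the classification. *)
Lemma F2_subsingleton U (nu : set U) (Gamma : set Omega) : ~ (`I_2 #<= Gamma) ->
  F2 Gamma nu `<=` F2 set0 nu.
Proof.
move=> /not_card_ge2 G1 f [[C|sG|[_ D]]|sf]; last by right.
- by left; apply: Or31.
- case: sG => _ []; apply: card_eq_leR; apply: card_image_inj => x y Gx Gy _.
  exact: G1.
- by left; apply: Or33; rewrite image_set0.
Qed.

Hypothesis nF1 : forall Gamma U (mu : set U), Gamma !=set0 -> Gamma `<=` Sigma ->
  infinite_set mu -> mu #<= succ_card Omega -> M <> F1 Gamma mu.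
Hypothesis nF2 : forall Gamma U (nu : set U), Gamma !=set0 -> Gamma `<=` Sigma ->
  infinite_set nu ->
  (Gamma #= `I_1 /\ nu #= succ_card Omega) \/
    (`I_2 #<= Gamma /\ nu #<= succ_card Omega) -> M <> F2 Gamma nu.

Let exists_not_F1 U (mu : set U) Gamma : Gamma !=set0 -> Gamma `<=` Sigma ->
  infinite_set mu -> mu #<= succ_card Omega -> exists2 h, M h & ~ F1 Gamma mu h.
Proof.
move=> G0 GS muinf muO; have Gfin := sub_finite_set GS Sfin.
apply: (maximal_not_sub Mmax); first exact: F1_subsemigroup.
  have [p _ nFp] := Sym_not_sub_F1 Oinf Gfin muinf G0.
  by move=> FT; apply: nFp; rewrite FT.
exact: nF1.
Qed.

Let exists_not_F2 U (nu : set U) Gamma : Gamma !=set0 -> Gamma `<=` Sigma ->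
  infinite_set nu ->
  (Gamma #= `I_1 /\ nu #= succ_card Omega) \/
    (`I_2 #<= Gamma /\ nu #<= succ_card Omega) -> exists2 h, M h & ~ F2 Gamma nu h.
Proof.
move=> G0 GS nuinf nuO; have Gfin := sub_finite_set GS Sfin.
apply: (maximal_not_sub Mmax); first exact: F2_subsemigroup.
  have [p _ nFp] := Sym_not_sub_F2 Oinf Gfin nuinf G0.
  by move=> FT; apply: nFp; rewrite FT.
exact: nF2.
Qed.

Let succ_infinite : infinite_set (succ_card Omega).
Proof. by apply: infinite_card_le Oinf _; have [[]] := succ_cardP Omega. Qed.

Let le_succ (nu : set Omega) : nu #<= succ_card Omega.
Proof.
by apply: card_le_trans (card_leT _) _; have [[]] := succ_cardP Omega.
Qed.

(** [full_escape] applies to the restrictions of elements of [M]: the escapes come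
    from maps outside [F2 Gamma nu] or, where [Gamma] has at most one point and
    [nu] is at most the cardinal of [Omega], outside [F2 set0 nu]. *)
Lemma full_embedding_in_M : exists f,
  [/\ M f, injective f, forall x, ~ Sigma (f x) & full (~` range f)].
Proof.
pose P A p := (forall x y, A x -> A y -> p x = p y -> x = y) /\
  exists2 h, M h & forall x, A x -> h x = p x.
have escP U (nu : set U) Gamma h : finite_set Gamma -> infinite_set nu -> M h ->
    ~ F2 Gamma nu h -> exists A p, P A p /\ escapes nu Gamma A p.
  move=> Gfin nuinf Mh /(F2_escape Oinf Gfin nuinf)[A [hinj Ah]].
  by exists A, h; split=> //; split=> //; exists h.
have [] := @full_escape _ Oinf Sigma Sfin P.
- by move=> A p [].
- move=> A B p r [pinj [h Mh hp]] [rinj [k Mk kr]] pAB.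
  have Bp x : A x -> B (p x) by move=> Ax; apply: pAB; exists x.
  split; first by move=> x y Ax Ay /rinj /pinj; auto.
  by exists (mulmap _ h k) => [|x Ax]; [exact: Mmul|rewrite /mulmap hp// kr//; exact: Bp].
- move=> q qG; split; last by exists q => //; exact: MSigma.
  by move=> x y _ _ /(bij_inj qG.1).
- have [h [Mh hinj hT]] := exists_injective_nonsurjective.
  by exists h; split=> //; split=> [x y _ _ /hinj//|]; exists h.
- move=> Gamma nu GS nuinf; have Gfin := sub_finite_set GS Sfin.
  have [G2|G1] := pselect (`I_2 #<= Gamma).
    have G0 : Gamma !=set0.
      apply/set0P/eqP => G0; move: G2; rewrite G0 card_le0 => /eqP I20.
      by have : @set0 nat 0 by rewrite -I20.
    by have [|h Mh nFh] := exists_not_F2 G0 GS nuinf; [right|exact: escP nFh].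
  have [h Mh nF0] := exists_not_F2_set0 nuinf.
  by apply: (escP _ _ _ h) => // /(F2_subsingleton G1).
- move=> Gamma GS G0; have Gfin := sub_finite_set GS Sfin.
  have [|h Mh nFh] := exists_not_F2 G0 GS succ_infinite; last exact: escP nFh.
  have [G2|G1] := pselect (`I_2 #<= Gamma); [by right|left; split=> //].
  have [c Gc] := G0; suff -> : Gamma = [set c] by exact: card_set1.
  by apply/seteqP; split=> [x Gx|_ ->//]; exact: not_card_ge2 G1 _ _ Gx Gc.
- move=> p [[pinj [h Mh hp]] pS pfull]; exists p; split=> //.
    by have <- : h = p by apply: funext => x; rewrite hp.
  by move=> x y; exact: pinj.
Qed.

(** [full_escape] applies to the partial sections of elements of [M] as well; a
    product of sections is a section of the product in the opposite order. *)
Lemma full_section_of_M : exists g s,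
  [/\ M g, cancel s g, forall x, ~ Sigma (s x) & full (~` range s)].
Proof.
pose P A p := exists2 h, M h & forall x : Omega, A x -> h (p x) = x.
have escP U (mu : set U) Gamma h : finite_set Gamma -> infinite_set mu -> M h ->
    ~ F1 Gamma mu h -> exists A p, P A p /\ escapes mu Gamma A p.
  move=> Gfin muinf Mh /(F1_escape Oinf Gfin muinf)[A [t [ht At]]].
  by exists A, t; split=> //; exists h.
have [] := @full_escape _ Oinf Sigma Sfin P.
- by move=> A p [h _ hp] x y Ax Ay e; rewrite -(hp x Ax) e hp.
- move=> A B p r [h Mh hp] [k Mk kr] pAB.
  exists (mulmap _ k h) => [|x Ax]; first exact: Mmul.
  by rewrite /mulmap kr ?hp//; apply: pAB; exists x.
- move=> q [[r qr rq] qS]; exists r => [|x _]; last exact: qr.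
  apply: MSigma; split; first by exists q.
  by move=> x Sx; rewrite -{1}(qS x Sx) qr.
- have [h [Mh hT hninj]] := exists_surjective_noninjective.
  have /choice[s hs] y : exists x, h x = y.
    by have [x _ <-] : range h y by [rewrite hT]; exists x.
  exists s; split; first by exists h.
  move=> sT; apply: hninj => x y.
  have [[u _ <-] [v _ <-]] : range s x /\ range s y by rewrite sT.
  by rewrite !hs => ->.
- move=> Gamma mu GS muinf; have Gfin := sub_finite_set GS Sfin.
  have [G0|/set0P G0] := eqVneq Gamma set0.
    have [h Mh nFh] := exists_not_F1_set0 muinf.
    by rewrite G0; exact: escP nFh.
  have [h Mh nFh] := exists_not_F1 G0 GS muinf (le_succ mu).
  exact: escP nFh.
- move=> Gamma GS G0; have Gfin := sub_finite_set GS Sfin.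
  have [h Mh nFh] := exists_not_F1 G0 GS succ_infinite (card_lexx _).
  exact: escP nFh.
- by move=> s [[g Mg gs] sS sfull]; exists g, s; split=> // x; exact: gs.
Qed.

(** The injection [f] and the section [s] leave [Sigma] untouched and have equally
    large complements, so the partial map sending [f x] to [s (p x)] extends to a
    permutation [q] fixing [Sigma]. *)
Lemma Sym_sub_M : Sym Omega `<=` M.
Proof.
move=> p pbij.
have [f [Mf finj fS ffull]] := full_embedding_in_M.
have [g [s [Mg sg sS sfull]]] := full_section_of_M.
have sinj := can_inj sg.
have /choice[ri riP] y : exists x, range f y -> f x = y.
  by have [[x _ <-]|ny] := pselect (range f y); [exists x|exists y].
have rif x : ri (f x) = x by apply: finj; apply: riP; exists x.
pose theta z := if pselect (Sigma z) is left _ then z else s (p (ri z)).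
have thS z : Sigma z -> theta z = z by rewrite /theta; case: pselect.
have thf x : theta (f x) = s (p x).
  by rewrite /theta; case: pselect => [/fS//|_ /=]; rewrite rif.
have [| | |q [r [qr rq qth]]] := @bijective_extension _ Oinf (Sigma `|` range f) theta.
- move=> y z [Sy|[x _ <-]] [Sz|[x' _ <-]].
  + by rewrite !thS.
  + by rewrite thS// thf => e; case: (sS (p x')); rewrite -e.
  + by rewrite (thS _ Sz) thf => e; case: (sS (p x)); rewrite e.
  + by rewrite !thf => /sinj /(bij_inj pbij) ->.
- by apply: full_sub (fullD Oinf Sfin ffull) => z [nz nSz] [].
- apply: full_sub (fullD Oinf Sfin sfull) => z [nz nSz] [y [Sy|[x _ <-]]].
    by rewrite thS// => yz; apply: nSz; rewrite -yz.
  by rewrite thf => xz; apply: nz; exists (p x).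
have -> : p = mulmap _ (mulmap _ f q) g.
  by apply: funext => x; rewrite /mulmap qth ?thf ?sg//; right; exists x.
apply: Mmul => //; apply: Mmul => //; apply: MSigma; split; first by exists r.
by move=> x Sx; rewrite qth ?thS//; left.
Qed.

End Converse.

Theorem theorem2 (Omega : Type) (Sigma : set Omega)
    (Omega_infinite : infinite_set [set: Omega])
    (Sigma_neq0 : Sigma !=set0) (Sigma_finite : finite_set Sigma) :
  forall M : set (Omega -> Omega),
    [/\ maximal_subsemigroup (mulmap Omega) M,
        pointwise_stabiliser Sigma `<=` M &
        ~ (Sym Omega `<=` M)]
    <->
    exists Gamma : set Omega,
      [/\ Gamma !=set0, Gamma `<=` Sigma &
        (exists (U : Type) (mu : set U),
           [/\ infinite_set mu, mu #<= succ_card Omega & M = F1 Gamma mu])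
        \/
        (exists (U : Type) (nu : set U),
           [/\ infinite_set nu,
               (Gamma #= `I_1 /\ nu #= succ_card Omega) \/
               (`I_2 #<= Gamma /\ nu #<= succ_card Omega)
             & M = F2 Gamma nu])].
Proof.
move=> M; split=> [[Mmax MS nSym]|[Gamma [G0 GS]]].
  apply: contrapT => nM; apply: (nSym).
  apply: (@Sym_sub_M _ Omega_infinite Sigma Sigma_finite M) => //.
  - move=> Gamma U mu G0 GS muinf muO ME; apply: nM; exists Gamma; split=> //.
    by left; exists U, mu.
  - move=> Gamma U nu G0 GS nuinf nuO ME; apply: nM; exists Gamma; split=> //.
    by right; exists U, nu.
have Gfin := sub_finite_set GS Sigma_finite.
case=> [[U [mu [muinf muO ->]]]|[U [nu [nuinf Gnu ->]]]]; split.
- exact: F1_maximal.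
- exact: pointwise_stabiliser_F1.
- have [p pS nFp] := Sym_not_sub_F1 Omega_infinite Gfin muinf G0.
  by move=> /(_ p pS).
- exact: F2_maximal.
- exact: pointwise_stabiliser_F2.
- have [p pS nFp] := Sym_not_sub_F2 Omega_infinite Gfin nuinf G0.
  by move=> /(_ p pS).
Qed.
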